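(* Let $(X,\mathcal{B},\mu,G)$ be a measure-preserving system with $G$ a countably infinite discrete amenable group. The following are equivalent: (1) $(X,\mathcal{B},\mu,G)$ has discrete spectrum; (2) the maximal pattern entropy of $(X,\mathcal{B},\mu,G)$ is zero; (3) every finite partition of $X$ has bounded mean complexity along $G$; (4) every finite partition of $X$ has bounded mean complexity with respect to any Følner sequence of $G$; (5) every finite partition of $X$ with two atoms has bounded mean complexity with respect to some Følner sequence of $G$; (6) every finite partition of $X$ is mean equicontinuous with respect to any tempered Følner sequence of $G$; (7) every finite partition of $X$ with two atoms is mean equicontinuous with respect to some tempered Følner sequence of $G$.
   Context: $(X,\mathcal{B},\mu)$ is a standard probability space with a measurable $\mu$-preserving action of $G$. The system has discrete spectrum if $L^2(\mu)$ is the closed linear span of finite-dimensional subspaces invariant under the Koopman operators $f\mapsto f\circ g$ (equivalently, $\{f\circ g\colon g\in G\}$ is precompact in $L^2(\mu)$ for every $f\in L^2(\mu)$). Finite partitions are identified mod $0$; $g^{-1}\alpha=\{g^{-1}A\colon A\in\alpha\}$; $H_\mu(\alpha)=-\sum_{A\in\alpha}\mu(A)\log\mu(A)$. Maximal pattern entropy of $\alpha$: $h^*_\mu(\alpha)=\limsup_n\frac1n\sup_{\alpha_1,\dots,\alpha_n\in\{g^{-1}\alpha\colon g\in G\}}H_\mu(\bigvee_{i=1}^n\alpha_i)$; that of the system is $\sup_\alpha h^*_\mu(\alpha)$ over all finite partitions. Følner sequence: nonempty finite $F_n\subset G$ with $|gF_n\triangle F_n|/|F_n|\to0$ for all $g$;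 tempered if there is $c>0$ with $|\bigcup_{1\le i<n}F_i^{-1}F_n|\le c|F_n|$ for $n\ge2$. For a finite nonempty set $E$ of partitions, $H_E(x,y)=\frac1{|E|}|\{\beta\in E\colon x,y\text{ in different atoms of }\beta\}|$, $B_{H_E}(x,\varepsilon)=\{y\colon H_E(x,y)<\varepsilon\}$, $\mathcal{C}(E,\varepsilon)=\min\{|D|\colon D\subset X\text{ finite},\ \mu(\bigcup_{x\in D}B_{H_E}(x,\varepsilon))>1-\varepsilon\}$. A partition $\alpha$ has bounded mean complexity along $G$ if for every $\varepsilon>0$ there is $C$ with $\mathcal{C}(E,\varepsilon)\le C$ for all finite nonempty $E\subset\{g^{-1}\alpha\colon g\in G\}$; with respect to $(F_n)$ if for every $\varepsilon>0$ there is $C$ with $\mathcal{C}(E_n,\varepsilon)\le C$ for all $n$, where $E_n=\{g^{-1}\alpha\colon g\in F_n\}$. $\alpha$ is mean equicontinuous w.r.t. $(F_n)$ if for every $\varepsilon>0$ there are pairwise disjoint measurable $B_1,\dots,B_k$ with $\mu(\bigcup_iB_i)>1-\varepsilon$ such that $\limsup_nH_{E_n}(x,y)<\varepsilon$ whenever $x,y\in B_i$ for some $i$.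
   Formalization: In H_E and E_n the translates of α are counted with multiplicity, indexed by group elements (g in F_n, or in a finite nonempty subset of G for (3)), not as a set of partitions; counted as a set, (5) does not imply (1) for some non-faithful actions. *)

(* Defs.v *)
From HB Require Import structures.
From mathcomp Require Import all_boot all_order all_algebra finmap.
From mathcomp Require Import all_classical all_reals all_analysis.
Set Implicit Arguments. Unset Strict Implicit. Unset Printing Implicit Defensive.
Import Order.TTheory GRing.Theory Num.Theory numFieldNormedType.Exports.
Local Open Scope classical_set_scope.
Local Open Scope ring_scope.

Record group_law (G : Type) := GroupLaw {
  gmul : G -> G -> G;
  ginv : G -> G;
  gone : G;
  gmulA : forall a b c, gmul a (gmul b c) = gmul (gmul a b) c;
  gmul1g : forall a, gmul gone a = a;
  gmulVg : forall a, gmul (ginv a) a = gone }.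

Section Groups.
Variables (G : choiceType) (L : group_law G).
Local Open Scope fset_scope.

Definition lmul_fset (g : G) (F : {fset G}) : {fset G} := [fset gmul L g x | x in F].

Definition folner (F : nat -> {fset G}) {R : realType} : Prop :=
  (forall n, F n != fset0) /\
  forall g : G,
    ((#|` ((lmul_fset g (F n) `\` F n) `|` (F n `\` lmul_fset g (F n)))|%:R
               / #|` F n|%:R : R) @[n --> \oo] --> (0 : R)).

(* tempered (indices shifted to start at 0): there is c > 0 with
   |U_{i<n} F_i^{-1} F_n| <= c |F_n| for all n >= 1 *)
Definition tempered (F : nat -> {fset G}) {R : realType} : Prop :=
  exists c : R, 0 < c /\
  forall n : nat, (1 <= n)%N ->
    (#|` [fset gmul L (ginv L a) b | a in \big[fsetU/fset0]_(i < n) F i, b in F n]|%:R : R)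
      <= c * #|` F n|%:R.

Definition amenable (R : realType) : Prop := exists F, @folner F R.
End Groups.

Section System.
Context {d : measure_display} (X : measurableType d) (R : realType).
Context (mu : probability X R).
Context (G : choiceType) (L : group_law G) (act : G -> X -> X).

(* standard Borel (Kuratowski): Borel-isomorphic to a Borel subset of R *)
Definition standard_borel : Prop :=
  exists f : X -> R, injective f /\ measurable_fun setT f /\
    forall A : set X, measurable A -> measurable (f @` A).

Definition mp_action : Prop :=
  (forall x, act (gone L) x = x) /\
  (forall g h x, act (gmul L g h) x = act g (act h x)) /\
  (forall g, measurable_fun setT (act g)) /\
  (forall g (A : set X), measurable A -> mu (act g @^-1` A) = mu A).

Definition is_partition (k : nat) (A : 'I_k -> set X) : Prop :=
  (forall i, measurable (A i)) /\
  (forall i j, i != j -> A i `&` A j = set0) /\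
  \bigcup_(i in setT) A i = setT.

Definition pr (B : set X) : R := fine (mu B).

Definition entropy (I : finType) (B : I -> set X) : R :=
  - \sum_(i : I) pr (B i) * ln (pr (B i)).

(* H_mu( g_1^{-1} alpha v ... v g_n^{-1} alpha ), where g^{-1}A = act g @^-1` A *)
Definition join_entropy (k n : nat) (A : 'I_k -> set X) (g : 'I_n -> G) : R :=
  entropy (fun t : {ffun 'I_n -> 'I_k} =>
             \bigcap_(j in [set: 'I_n]) (act (g j) @^-1` A (t j))).

Definition max_pattern_entropy_part (k : nat) (A : 'I_k -> set X) : \bar R :=
  limn_esup (fun n : nat =>
    ereal_sup [set ((n%:R)^-1 * join_entropy A g)%:E | g in [set: 'I_n -> G]]).

Definition max_pattern_entropy : \bar R :=
  ereal_sup [set e | exists (k : nat) (A : 'I_k -> set X),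
                       is_partition A /\ e = max_pattern_entropy_part A].

(* discrete spectrum: every orbit {f o g : g in G} in L^2(mu) is precompact,
   i.e. totally bounded (L^2 is complete) *)
Definition discrete_spectrum : Prop :=
  forall f : X -> R, measurable_fun setT f ->
    mu.-integrable setT (fun x => (f x ^+ 2)%:E) ->
    forall eps : R, 0 < eps ->
      exists s : seq G, forall g : G, exists2 h, h \in s &
        (\int[mu]_x ((f (act g x) - f (act h x)) ^+ 2)%:E <= (eps ^+ 2)%:E)%E.

Definition sep (k : nat) (A : 'I_k -> set X) (g : G) (x y : X) : Prop :=
  exists i, A i (act g x) /\ ~ A i (act g y).

Local Open Scope fset_scope.
(* H_E(x,y) for E = {g^{-1} alpha : g in S}, indexed by the finite set S *)
Definition Hdist (k : nat) (A : 'I_k -> set X) (S : {fset G}) (x y : X) : R :=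
  (#|` [fset g in S | `[< sep A g x y >]]|%:R / #|` S|%:R)%R.
Local Close Scope fset_scope.

Definition Hball k (A : 'I_k -> set X) (S : {fset G}) (x : X) (eps : R) : set X :=
  [set y | Hdist A S x y < eps].

Definition complexity_le k (A : 'I_k -> set X) (S : {fset G}) (eps : R) (C : nat)
  : Prop :=
  exists (m : nat) (D : 'I_m -> X), (m <= C)%N /\
    ((1 - eps)%:E < mu (\bigcup_(i in [set: 'I_m]) Hball A S (D i) eps))%E.

Definition bmc_along_G k (A : 'I_k -> set X) : Prop :=
  forall eps : R, 0 < eps -> exists C : nat,
    forall S : {fset G}, S != fset0 -> complexity_le A S eps C.

Definition bmc_wrt k (A : 'I_k -> set X) (F : nat -> {fset G}) : Prop :=
  forall eps : R, 0 < eps -> exists C : nat,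
    forall n, complexity_le A (F n) eps C.

Definition mean_equicont k (A : 'I_k -> set X) (F : nat -> {fset G}) : Prop :=
  forall eps : R, 0 < eps ->
    exists (m : nat) (B : 'I_m -> set X),
      (forall i, measurable (B i)) /\
      (forall i j, i != j -> B i `&` B j = set0) /\
      ((1 - eps)%:E < mu (\bigcup_(i in [set: 'I_m]) B i))%E /\
      (forall i x y, B i x -> B i y ->
         (limn_esup (fun n => (Hdist A (F n) x y)%:E) < eps%:E)%E).
End System.

(* Main.v *)
Require Import Defs.
From HB Require Import structures.
From mathcomp Require Import all_boot all_order all_algebra finmap.
From mathcomp Require Import all_classical all_reals all_analysis.
From mathcomp Require Import measurable_realfun ring lra.
Set Implicit Arguments. Unset Strict Implicit. Unset Printing Implicit Defensive.
Import Order.TTheory GRing.Theory Num.Theory numFieldNormedType.Exports.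
Local Open Scope classical_set_scope.
Local Open Scope ring_scope.

(** A system has discrete spectrum iff, for every measurable set [B], the group is
    totally bounded for the right-invariant pseudometric
    [rho g h = mu (g^-1 B symdiff h^-1 B)]; everything is compared with this property.

    - Entropy: if [rho] is totally bounded, every translate of a partition is
      predicted with small error by a finite net, and Gibbs' inequality against
      the corresponding product distribution makes the pattern entropy vanish.
      Conversely, if [rho] is not totally bounded, no finite join predicts all
      translates of [B], and choosing the translates greedily gains a fixed
      amount of entropy at each step.
    - Complexity: a net together with Markov's inequality bounds the complexity.
      Conversely, bounded complexity along a Folner sequence makes a fixed
      proportion of each [F n] lie in one [rho]-ball; left translates of that
      ball by elements of a separated family are disjoint and have almost the
      same density, so separated families are bounded in size.
    - Mean equicontinuity: averaging [f] over [(F n)^-1] with a weight concentrated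
      near the identity for [rho], and passing to the upper limit along a fast
      subsequence, yields [g] close to [f] in L^1 whose translates
      satisfy [|g (a x) - g (b x)| <= K rho a b] at every point; the maximal
      inequality for tempered sequences controls the averages of [|g - f|]. The
      maximal inequality follows from a deterministic fractional covering lemma. *)

(** * Groups and Folner sequences *)

Section GroupLaw.
Variables (G : Type) (L : group_law G).
Local Notation "a ** b" := (gmul L a b) (at level 40, left associativity).
Local Notation inv := (ginv L).

Lemma gmulKV a b : inv a ** (a ** b) = b.
Proof. by rewrite gmulA gmulVg gmul1g. Qed.

Lemma gmul_injl a b c : a ** b = a ** c -> b = c.
Proof. by move=> h; rewrite -(gmulKV a b) h gmulKV. Qed.

Lemma gmulg1 a : a ** gone L = a.
Proof. by apply: (@gmul_injl (inv a)); rewrite gmulA gmulVg gmul1g. Qed.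

Lemma gmulgV a : a ** inv a = gone L.
Proof. by apply: (@gmul_injl (inv a)); rewrite gmulA gmulVg gmul1g gmulg1. Qed.

Lemma gmulVK a b : a ** (inv a ** b) = b.
Proof. by rewrite gmulA gmulgV gmul1g. Qed.

Lemma ginvK a : inv (inv a) = a.
Proof. by apply: (@gmul_injl (inv a)); rewrite gmulgV gmulVg. Qed.

Lemma gmulgK a b : (a ** b) ** inv b = a.
Proof. by rewrite -gmulA gmulgV gmulg1. Qed.

Lemma gmulgKV a b : (a ** inv b) ** b = a.
Proof. by rewrite -gmulA gmulVg gmulg1. Qed.

Lemma gmul_injr a b c : b ** a = c ** a -> b = c.
Proof. by move=> h; rewrite -(gmulgK b a) h gmulgK. Qed.

End GroupLaw.

Section FiniteSums.
Variables (R : realDomainType) (G : choiceType).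
Local Open Scope fset_scope. Local Open Scope ring_scope.
Implicit Types (A B F : {fset G}) (v : G -> R).

Lemma sum_cst_fset A (c : R) : \sum_(a <- A) c = c * #|` A|%:R.
Proof. by rewrite big_const_seq iter_addr_0 count_predT mulr_natr. Qed.

Lemma card_sum_fset A : (#|` A|%:R : R) = \sum_(a <- A) 1.
Proof. by rewrite sum_cst_fset mul1r. Qed.

Lemma card_filter_fset A (b : pred G) :
  (#|` [fset a in A | b a]|%:R : R) = \sum_(a <- A) (b a)%:R.
Proof.
rewrite card_sum_fset big_fset big_mkcond; apply: eq_bigr => a _.
by case: (b a).
Qed.

Lemma sum_bounded_fset A v (C : R) : (forall k, `|v k| <= C) ->
  `|\sum_(k <- A) v k| <= C * #|` A|%:R.
Proof.
move=> vC; rewrite -sum_cst_fset.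
by apply: (le_trans (ler_norm_sum _ _ _)); apply: ler_sum => k _.
Qed.

Lemma sum_fset_ID A B v :
  \sum_(k <- A) v k = \sum_(k <- A `&` B) v k + \sum_(k <- A `\` B) v k.
Proof.
rewrite (big_fsetID _ (mem B)); congr (_ + _); apply: eq_fbigl => k;
by rewrite !inE //= andbC.
Qed.

(** The terms over the intersection cancel, so only the symmetric difference contributes. *)
Lemma sum_symdiff A B v (C : R) : (forall k, `|v k| <= C) ->
  `|\sum_(k <- A) v k - \sum_(k <- B) v k|
    <= C * #|` (A `\` B) `|` (B `\` A)|%:R.
Proof.
move=> vC; rewrite (sum_fset_ID A B) (sum_fset_ID B A) (fsetIC B A).
rewrite opprD addrACA subrr add0r (le_trans (ler_normB _ _))//.
rewrite (le_trans (lerD (sum_bounded_fset _ vC) (sum_bounded_fset _ vC)))//.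
rewrite -mulrDr -natrD.
have -> : (#|` A `\` B| + #|` B `\` A|)%N = #|` (A `\` B) `|` (B `\` A)|.
  rewrite -cardfsUI; set I := (_ `&` _).
  suff -> : I = fset0 by rewrite cardfs0 addn0.
  by apply/fsetP => k; rewrite !inE; case: (k \in A); case: (k \in B).
by [].
Qed.

End FiniteSums.

Section Folner.
Variables (R : realType) (G : choiceType) (L : group_law G).
Local Open Scope fset_scope. Local Open Scope ring_scope.
Local Notation "a ** b" := (gmul L a b) (at level 40, left associativity).
Implicit Types (A B F : {fset G}) (v : G -> R).

Definition boundary (g : G) (F : {fset G}) : R :=
  #|` (lmul_fset L g F `\` F) `|` (F `\` lmul_fset L g F)|%:R.

(** Reindexing by the injective left translation turns the first sum into one over [g F]. This is
    the source of the approximate left invariance of sums over Folner sets. *)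
Lemma sum_translate g F v (C : R) : (forall k, `|v k| <= C) ->
  `|\sum_(k <- F) v (g ** k) - \sum_(k <- F) v k| <= C * boundary g F.
Proof.
move=> vC; rewrite -[X in `|X - _|](_ : \sum_(k <- lmul_fset L g F) v k = _).
  exact: sum_symdiff.
by rewrite big_imfset //= => a b _ _; exact: gmul_injl.
Qed.

Lemma folner_small (F : nat -> {fset G}) : @folner G L F R ->
  forall (s : seq G) (e : R), 0 < e ->
  exists N, forall n, (N <= n)%N ->
    forall g, g \in s -> boundary g (F n) <= e * #|` F n|%:R.
Proof.
move=> [F0 FF] s e e0; elim: s => [|g s [N IH]]; first by exists 0%N.
have /cvgrPdist_le /(_ _ e0) [M _ HM] := FF g.
exists (maxn N M) => n; rewrite geq_max => /andP[Nn Mn] h.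
rewrite inE => /orP[/eqP ->|hs]; last exact: IH.
have := HM n Mn; rewrite /= sub0r normrN.
rewrite ger0_norm ?divr_ge0 // ler_pdivrMr //.
by rewrite ltr0n cardfs_gt0.
Qed.

Lemma folner_gt0 (F : nat -> {fset G}) n : @folner G L F R ->
  0 < (#|` F n|%:R : R).
Proof. by move=> [F0 _]; rewrite ltr0n cardfs_gt0. Qed.

(** An element of [A K] outside [K] lies in [a K] minus [K] for some [a] in [A]; the union bound
    does the rest. *)
Lemma card_mul_setD A K :
  (#|` [fset a ** b | a in A, b in K] `\` K|%:R : R) <= \sum_(a <- A) boundary a K.
Proof.
apply: (@le_trans _ _ (\sum_(a <- A) #|` lmul_fset L a K `\` K|%:R)); last first.
  by apply: ler_sum => a _; rewrite ler_nat fsubset_leq_card // fsubsetUl.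
rewrite -natr_sum ler_nat.
apply: (@leq_trans #|` \bigcup_(a <- A) (lmul_fset L a K `\` K)|); last first.
  elim: (enum_fset A) => [|a s IH]; first by rewrite !big_nil cardfs0.
  by rewrite !big_cons (leq_trans (leq_card_fsetU _ _))// leq_add2l.
apply: fsubset_leq_card; apply/fsubsetP => z; rewrite inE => /andP[zK].
move=> /imfset2P[a /= aA [b /= bK zE]].
apply/bigfcupP; exists a; rewrite ?aA// !inE zK.
by apply/imfsetP; exists b.
Qed.

End Folner.

(** * Integration of bounded functions and the orbit pseudometric *)

Section BoundedIntegral.
Context {d : measure_display} {X : measurableType d} {R : realType}.
Variable mu : probability X R.

(** Most integrands below are of this kind; the closure rules that follow discharge their
    integrability conditions. *)
Definition bounded_measurable (f : X -> R) : Prop :=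
  measurable_fun setT f /\ exists C : R, forall x, `|f x| <= C.
Local Notation bm := bounded_measurable.

Definition mean (f : X -> R) : R := \int[mu]_x f x.

(** Finite partitions are handled as maps to a finite type. Asking for measurable fibres avoids
    putting a sigma-algebra on [T]. *)
Definition measurable_fibers (T : finType) (t : X -> T) : Prop :=
  forall i, measurable (t @^-1` [set i]).
Local Notation mfib := measurable_fibers.

Lemma bm_integrable f : bm f -> mu.-integrable setT (EFin \o f).
Proof.
move=> [mf [C fC]]; apply: measurable_bounded_integrable => //.
  by rewrite ltey_eq fin_num_measure.
exists C; split; first exact: num_real.
by move=> M CM x _; apply: le_trans (fC x) _; exact: ltW.
Qed.

Lemma bm_cst c : bm (fun=> c).
Proof. by split; [exact: measurable_cst|exists `|c|]. Qed.

Lemma bmD f g : bm f -> bm g -> bm (fun x => f x + g x).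
Proof.
move=> [mf [C fC]] [mg [D gD]]; split; first exact: measurable_funD.
by exists (C + D) => x; apply: le_trans (ler_normD _ _) _; apply: lerD.
Qed.

Lemma bmM f g : bm f -> bm g -> bm (fun x => f x * g x).
Proof.
move=> [mf [C fC]] [mg [D gD]]; split; first exact: measurable_funM.
by exists (C * D) => x; rewrite normrM ler_pM.
Qed.

Lemma bmN f : bm f -> bm (fun x => - f x).
Proof.
move=> [mf [C fC]]; split; first exact: measurableT_comp.
by exists C => x; rewrite normrN.
Qed.

Lemma bmB f g : bm f -> bm g -> bm (fun x => f x - g x).
Proof. by move=> bf bg; apply: bmD => //; apply: bmN. Qed.

Lemma bm_norm f : bm f -> bm (fun x => `|f x|).
Proof.
move=> [mf [C fC]]; split; last by exists C => x; rewrite normr_id.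
exact: measurableT_comp.
Qed.

Lemma bm_sum (I : Type) (s : seq I) (P : pred I) (F : I -> X -> R) :
  (forall i, bm (F i)) -> bm (fun x => \sum_(i <- s | P i) F i x).
Proof.
move=> bF; elim: s => [|i s IH].
  by under eq_fun do rewrite big_nil; exact: bm_cst.
under eq_fun do rewrite big_cons; case: (P i) => //; exact: bmD.
Qed.

Lemma bm_ge0 f : bm f -> exists2 C : R, 0 < C & forall x, `|f x| <= C.
Proof.
move=> [_ [C fC]]; exists (`|C| + 1); first by rewrite ltr_wpDl.
by move=> x; rewrite (le_trans (fC x))// (le_trans (ler_norm C))// lerDl.
Qed.

Lemma mean_cst c : mean (fun=> c) = c.
Proof.
rewrite /mean Rintegral_cst// (_ : fine _ = 1) ?mulr1//.
exact: (congr1 fine (probability_setT mu)).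
Qed.

Lemma meanD f g : bm f -> bm g -> mean (fun x => f x + g x) = mean f + mean g.
Proof. by move=> bf bg; rewrite /mean RintegralD//; exact: bm_integrable. Qed.

Lemma meanZ c f : bm f -> mean (fun x => c * f x) = c * mean f.
Proof. by move=> bf; rewrite /mean RintegralZl//; exact: bm_integrable. Qed.

Lemma mean_sum (I : Type) (s : seq I) (P : pred I) (F : I -> X -> R) :
  (forall i, bm (F i)) ->
  mean (fun x => \sum_(i <- s | P i) F i x) = \sum_(i <- s | P i) mean (F i).
Proof.
move=> bF; elim: s => [|i s IH].
  by under eq_fun do rewrite big_nil; rewrite mean_cst big_nil.
under eq_fun do rewrite big_cons; rewrite big_cons.
case: (P i) => //; rewrite meanD ?IH//; exact: bm_sum.
Qed.

Lemma le_mean f g : bm f -> bm g -> (forall x, f x <= g x) -> mean f <= mean g.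
Proof. by move=> bf bg fg; apply: le_Rintegral => //; exact: bm_integrable. Qed.

Lemma mean_ge0 f : (forall x, 0 <= f x) -> 0 <= mean f.
Proof. by move=> f0; apply: Rintegral_ge0. Qed.

Lemma EFin_mean f : bm f -> (mean f)%:E = (\int[mu]_x (f x)%:E)%E.
Proof.
move=> /bm_integrable bf; rewrite /mean /Rintegral fineK//.
exact: integrable_fin_num.
Qed.

Lemma mu_pr A : measurable A -> mu A = (pr mu A)%:E.
Proof. by move=> mA; rewrite /pr fineK// fin_num_measure. Qed.

Lemma bm_indic A : measurable A -> bm (\1_A).
Proof.
move=> mA; split; first exact: measurable_indic.
by exists 1 => x; rewrite indicE; case: (x \in A); rewrite ?normr1 ?normr0.
Qed.

Lemma mean_indic A : measurable A -> mean \1_A = pr mu A.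
Proof. by move=> mA; rewrite /mean /Rintegral integral_indic// setIT. Qed.

Lemma pr_ge0 A : 0 <= pr mu A.
Proof. exact: fine_ge0. Qed.

Lemma pr_le1 A : measurable A -> pr mu A <= 1.
Proof. by move=> mA; rewrite -lee_fin -mu_pr// probability_le1. Qed.

Lemma prT : pr mu setT = 1.
Proof. by rewrite /pr probability_setT. Qed.

Lemma prC A : measurable A -> pr mu (~` A) = 1 - pr mu A.
Proof.
move=> mA; have mC := measurableC mA.
by apply: EFin_inj; rewrite -mu_pr// EFinB -mu_pr// probability_setC.
Qed.

Lemma le_pr A B : measurable A -> measurable B -> A `<=` B -> pr mu A <= pr mu B.
Proof. by move=> mA mB AB; rewrite -lee_fin -!mu_pr// le_measure// inE. Qed.

Lemma markov_mean f (l : R) : bm f -> (forall x, 0 <= f x) -> 0 < l ->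
  measurable [set x | l <= f x] /\ l * pr mu [set x | l <= f x] <= mean f.
Proof.
move=> bf f0 l0; have mS : measurable [set x | l <= f x].
  rewrite (_ : [set x | _] = f @^-1` `[l, +oo[); last first.
    by apply/seteqP; split => x /=; rewrite in_itv /= andbT.
  by rewrite -[_ @^-1` _]setTI; case: bf => mf _; exact: mf.
split=> //; rewrite -mean_indic// -meanZ; last exact: bm_indic.
apply: le_mean => //; first by apply: bmM; [exact: bm_cst|exact: bm_indic].
move=> x; rewrite indicE.
have [xS|_] := boolP (x \in [set y | l <= f y]); last by rewrite mulr0.
by rewrite mulr1; move: xS; rewrite inE.
Qed.

Lemma measurable_fibers_preimage (T : finType) (t : X -> T) (P : set T) :
  mfib t -> measurable (t @^-1` P).
Proof.
move=> mt; rewrite (_ : _ @^-1` _ = \bigcup_(i in P) (t @^-1` [set i])).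
  by apply: fin_bigcup_measurable => //; exact: finite_finset.
apply/seteqP; split => [x Px|x [i /= Pi ti]]; first by exists (t x).
by rewrite /= ti.
Qed.

Lemma bm_fibers (T : finType) (t : X -> T) (h : T -> R) :
  mfib t -> bm (fun x => h (t x)).
Proof.
move=> mt; split; last first.
  exists (\sum_i `|h i|) => x /=; rewrite (bigD1 (t x)) //= lerDl.
  by apply: sumr_ge0.
move=> _ Y _; rewrite setTI.
exact: (@measurable_fibers_preimage _ t (h @^-1` Y)).
Qed.

Lemma measurable_fibers_comp (T U : finType) (t : X -> T) (h : T -> U) :
  mfib t -> mfib (fun x => h (t x)).
Proof.
by move=> mt i; exact: (@measurable_fibers_preimage _ t (h @^-1` [set i])).
Qed.

Lemma measurable_fibers_pair (T U : finType) (t : X -> T) (u : X -> U) :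
  mfib t -> mfib u -> mfib (fun x => (t x, u x)).
Proof.
move=> mt mu' [i j]; rewrite (_ : _ @^-1` _ = t @^-1` [set i] `&` u @^-1` [set j]).
  exact: measurableI.
by apply/seteqP; split => x /= => [[-> ->]|[-> ->]].
Qed.

Lemma measurable_fibers_ffun (J T : finType) (t : J -> X -> T) :
  (forall j, mfib (t j)) -> mfib (fun x => [ffun j => t j x]).
Proof.
move=> mt f.
rewrite (_ : _ @^-1` _ = \bigcap_(j in [set: J]) (t j @^-1` [set f j])).
  apply: fin_bigcap_measurable => [|j _]; last exact: mt.
  exact: finite_finset.
apply/seteqP; split => x /=.
  by move=> fE j _ /=; rewrite -fE ffunE.
by move=> h; apply/ffunP => j; rewrite ffunE; exact: h.
Qed.

Lemma measurable_fibers_bool A : measurable A -> mfib (fun x => x \in A).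
Proof.
move=> mA [].
  rewrite (_ : _ @^-1` _ = A)//; apply/seteqP; split => x /=; first exact: set_mem.
  exact: mem_set.
rewrite (_ : _ @^-1` _ = ~` A); first exact: measurableC.
apply/seteqP; split => x /=; last exact: memNset.
by move=> + Ax; rewrite mem_set.
Qed.

Lemma mean_fibers (T : finType) (t : X -> T) (h : T -> R) : mfib t ->
  mean (fun x => h (t x)) = \sum_i pr mu (t @^-1` [set i]) * h i.
Proof.
move=> mt.
transitivity (mean (fun x => \sum_i h i * \1_(t @^-1` [set i]) x)).
  congr mean; apply/funext => x; rewrite (bigD1 (t x)) //= big1.
    by rewrite indicE mem_set// mulr1 addr0.
  by move=> i ti; rewrite indicE memNset ?mulr0// => /= E; rewrite E eqxx in ti.
rewrite mean_sum => [|i]; last first.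
  by apply: bmM; [exact: bm_cst|exact/bm_indic/mt].
apply: eq_bigr => i _.
by rewrite meanZ ?mean_indic 1?mulrC//; exact/bm_indic/mt.
Qed.

End BoundedIntegral.
Arguments bounded_measurable {d X R} f.
Arguments measurable_fibers {d X T} t.

Section Action.
Context {d : measure_display} {X : measurableType d} {R : realType}.
Variables (mu : probability X R) (G : choiceType) (L : group_law G).
Variable act : G -> X -> X.
Hypothesis Hact : mp_action mu L act.
Local Notation "a ** b" := (gmul L a b) (at level 40, left associativity).
Local Notation inv := (ginv L).
Local Notation bm := (@bounded_measurable d X R).
Local Notation mfib := measurable_fibers.
Local Notation mean := (mean mu).

Lemma act1 x : act (gone L) x = x. Proof. by case: Hact. Qed.

Lemma actM g h x : act (g ** h) x = act g (act h x).
Proof. by case: Hact => _ []. Qed.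

Lemma measurable_act g : measurable_fun setT (act g).
Proof. by case: Hact => _ [_ []]. Qed.

Lemma mu_act g A : measurable A -> mu (act g @^-1` A) = mu A.
Proof. by case: Hact => _ [_ [_ +]]; apply. Qed.

Lemma measurable_act_preimage g A : measurable A -> measurable (act g @^-1` A).
Proof. by move=> mA; rewrite -[_ @^-1` _]setTI; exact: measurable_act. Qed.

Lemma integral_act g (f : X -> \bar R) : measurable_fun setT f ->
  (forall x, (0 <= f x)%E) ->
  (\int[mu]_x f (act g x) = \int[mu]_x f x)%E.
Proof.
move=> mf f0; have mg := measurable_act g.
transitivity (\int[pushforward mu (act g)]_y f y)%E.
  by rewrite ge0_integral_pushforward// preimage_setT.
by apply: eq_measure_integral => A mA _; exact: mu_act.
Qed.

Lemma bm_act g f : bm f -> bm (fun x => f (act g x)).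
Proof.
move=> [mf [C fC]]; split; last by exists C => x.
exact: measurableT_comp (measurable_act g).
Qed.

Lemma mean_act g f : bm f -> mean (fun x => f (act g x)) = mean f.
Proof.
move=> bf; have [C C0 fC] := bm_ge0 bf.
have b1 : bm (fun x => f x + C) by apply: bmD => //; exact: bm_cst.
(* [integral_act] is for nonnegative functions, so [f] is raised by its bound [C], which cancels
   afterwards. *)
suff : mean (fun x => f (act g x) + C) = mean (fun x => f x + C).
  by rewrite !meanD ?mean_cst; [exact: addIr|exact: bf|exact: bm_cst
    |exact: bm_act|exact: bm_cst].
apply: EFin_inj; rewrite !EFin_mean//; last by apply: bm_act b1.
apply: (@integral_act g (fun x => (f x + C)%:E)).
  by apply/measurable_EFinP; case: b1.
move=> x; rewrite lee_fin -lerBlDr sub0r.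
by have := fC x; rewrite ler_norml => /andP[].
Qed.

Lemma measurable_fibers_act (T : finType) (t : X -> T) g :
  mfib t -> mfib (fun x => t (act g x)).
Proof. by move=> mt i; exact: (measurable_act_preimage g (mt i)). Qed.

(** The L^1 distance between two translates of [f]. For [f = \1_B] it is the measure of the
    symmetric difference of [g^-1 B] and [h^-1 B]. *)
Definition orbit_dist (f : X -> R) (g h : G) : R :=
  mean (fun x => `|f (act g x) - f (act h x)|).
Local Notation rho := orbit_dist.

Section Dist.
Variable f : X -> R.
Hypothesis bf : bm f.

Lemma bm_orbit_diff g h : bm (fun x => `|f (act g x) - f (act h x)|).
Proof. by apply/bm_norm/bmB; exact: bm_act. Qed.

Lemma orbit_dist_ge0 g h : 0 <= rho f g h.
Proof. exact: mean_ge0. Qed.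

Lemma orbit_distC g h : rho f g h = rho f h g.
Proof. by congr mean; apply/funext => x; rewrite distrC. Qed.

Lemma orbit_dist_triangle g h k : rho f g k <= rho f g h + rho f h k.
Proof.
rewrite -meanD; [|exact: bm_orbit_diff|exact: bm_orbit_diff].
apply: le_mean => [||x]; first exact: bm_orbit_diff.
  by apply: bmD; exact: bm_orbit_diff.
by rewrite -[leLHS]/`|_ - _| (le_trans _ (ler_normD _ _))// addrA subrK.
Qed.

(** Right multiplication by [k] composes both translates with [act k], which preserves the
    integral. *)
Lemma orbit_distMr g h k : rho f (g ** k) (h ** k) = rho f g h.
Proof.
rewrite -[RHS](mean_act k); last exact: bm_orbit_diff.
by congr mean; apply/funext => x; rewrite !actM.
Qed.

End Dist.
End Action.

(** * Total boundedness: finite colourings and finite nets *)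

Section TotallyBounded.
Variables (R : realType) (G : Type).

(* Total boundedness of a pseudometric, phrased with colourings so that finitely
   many distances can be treated at once by taking products of colour sets. *)
Definition finitely_colourable (dist : G -> G -> R) : Prop :=
  forall e : R, 0 < e -> exists (T : finType) (c : G -> T),
    forall g h, c g = c h -> dist g h <= e.

Lemma colourable_net (dist : G -> G -> R) : finitely_colourable dist ->
  forall e : R, 0 < e -> exists (m : nat) (s : 'I_m -> G),
    forall g, exists i, dist g (s i) <= e.
Proof.
move=> H e /H[T [c cP]].
(* Colours that are not attained need a default representative [g0]; if [G] is empty, the empty net
   serves. *)
have [g0|noG] := pselect (inhabited G); last first.
  exists 0%N, (fun i : 'I_0 => match notF (ltn_ord i) with end) => g.
  by exfalso; apply: noG; exists.
case: g0 => g0.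
have /choice[s sP] : forall t : T, exists g, (exists h, c h = t) -> c g = t.
  move=> t; have [[h ht]|no] := pselect (exists h, c h = t); first by exists h.
  by exists g0.
exists #|T|, (fun i => s (enum_val i)) => g; exists (enum_rank (c g)).
by apply: cP; rewrite enum_rankK sP//; exists g.
Qed.

Lemma net_colourable (dist : G -> G -> R) :
  (forall g h, dist g h = dist h g) ->
  (forall g h k, dist g k <= dist g h + dist h k) ->
  (forall e : R, 0 < e -> exists (m : nat) (s : 'I_m -> G),
    forall g, exists i, dist g (s i) <= e) ->
  finitely_colourable dist.
Proof.
move=> dC dT H e e0; have e2 : 0 < e / 2 by rewrite divr_gt0.
have [m [s /choice[c cP]]] := H _ e2.
exists 'I_m, c => g h gh; apply: (le_trans (dT g (s (c g)) h)).
by rewrite [leRHS]splitr lerD// dC gh.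
Qed.

End TotallyBounded.

(** * Discrete spectrum and total boundedness *)

Import HBSimple.

Section DiscreteSpectrum.
Context {d : measure_display} {X : measurableType d} {R : realType}.
Variables (mu : probability X R) (G : choiceType) (L : group_law G).
Variable act : G -> X -> X.
Hypothesis Hact : mp_action mu L act.
Local Notation bm := (@bounded_measurable d X R).
Local Notation mfib := measurable_fibers.
Local Notation mean := (mean mu).
Local Notation rho := (orbit_dist mu act).
Local Notation colourable := (@finitely_colourable R G).

(** Integers satisfy [|z| <= z ^ 2]. For index functions of partitions this bounds the L^1 distance
    by the squared L^2 distance, so the next lemma asks for L^2 radius [Num.sqrt e]. *)
Lemma natr_dist_le_sqr (m n : nat) : (`|m%:R - n%:R| : R) <= (m%:R - n%:R) ^+ 2.
Proof.
wlog mn : m n / (n <= m)%N.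
  by move=> H; case: (leqP n m) => [|/ltnW] /H //; rewrite distrC -sqrrN opprB.
rewrite -natrB// normr_nat -natrX ler_nat.
by case: (m - n)%N => // k; rewrite -mulnn leq_pmulr.
Qed.

Lemma discrete_spectrum_colourable k (t : X -> 'I_k) : mfib t ->
  discrete_spectrum mu act -> colourable (rho (fun x => (t x)%:R)).
Proof.
move=> mt DS; set f : X -> R := fun x => (t x)%:R.
have bf : bm f by apply: (@bm_fibers _ _ _ _ t (fun i : 'I_k => (i : nat)%:R)).
apply: net_colourable; [exact: orbit_distC|by move=> *; exact: (orbit_dist_triangle Hact)|].
move=> e e0; have s0 : 0 < Num.sqrt e by rewrite sqrtr_gt0.
have bff : bm (fun x => f x ^+ 2) by exact: bmM.
have [||s sP] := DS f _ _ _ s0; [by case: bf|exact: (bm_integrable mu bff)|].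
have g0 : inhabited G by exists; exact: (gone L).
exists (size s), (fun i => nth (gone L) s i) => g.
have [h hs hg] := sP g.
have hi : (index h s < size s)%N by rewrite index_mem.
exists (Ordinal hi); rewrite /= nth_index//.
have bq : bm (fun x => (f (act g x) - f (act h x)) ^+ 2).
  by apply: bmM; apply: bmB; exact: (bm_act Hact).
rewrite -EFin_mean// lee_fin (sqr_sqrtr (ltW e0)) in hg.
apply: le_trans hg; apply: le_mean => // [|x]; last exact: natr_dist_le_sqr.
exact: (bm_orbit_diff Hact).
Qed.

Lemma colourableD f g : bm f -> bm g -> colourable (rho f) -> colourable (rho g) ->
  colourable (rho (fun x => f x + g x)).
Proof.
move=> bf bg cf cg e e0; have e2 : 0 < e / 2 by rewrite divr_gt0.
have [T [a aP]] := cf _ e2; have [U [b bP]] := cg _ e2.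
exists (T * U)%type, (fun x => (a x, b x)) => x y [xa xb].
rewrite [leRHS]splitr; apply: le_trans (lerD (aP _ _ xa) (bP _ _ xb)).
rewrite -meanD; try exact: (bm_orbit_diff Hact).
apply: le_mean; first exact: (bm_orbit_diff Hact (bmD bf bg)).
  by apply: bmD; exact: (bm_orbit_diff Hact).
by move=> z; rewrite opprD addrACA ler_normD.
Qed.

Lemma colourableZ c f : bm f -> colourable (rho f) ->
  colourable (rho (fun x => c * f x)).
Proof.
move=> bf cf e e0; have c0 : 0 < `|c| + 1 by rewrite ltr_wpDl.
have [T [a aP]] := cf _ (divr_gt0 e0 c0).
exists T, a => x y xy; have := aP _ _ xy; rewrite ler_pdivlMr// mulrC.
apply: le_trans; rewrite -meanZ; last exact: (bm_orbit_diff Hact).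
apply: le_mean; first exact: (bm_orbit_diff Hact (bmM (bm_cst c) bf)).
  by apply: bmM; [exact: bm_cst|exact: (bm_orbit_diff Hact)].
by move=> z; rewrite -mulrBr normrM ler_wpM2r// lerDl.
Qed.

Lemma colourable_sum (I : Type) (s : seq I) (F : I -> X -> R) :
  (forall i, bm (F i)) -> (forall i, colourable (rho (F i))) ->
  colourable (rho (fun x => \sum_(i <- s) F i x)).
Proof.
move=> bF cF; elim: s => [|i s IH].
  under eq_fun do rewrite big_nil.
  move=> e e0; exists unit, (fun=> tt) => g h _; rewrite /orbit_dist.
  by under eq_fun do rewrite subrr normr0; rewrite mean_cst ltW.
under eq_fun do rewrite big_cons.
by apply: colourableD => //; exact: bm_sum.
Qed.

(** A colouring for [g] at scale [e / 2] works for [f] at scale [e]: by invariance each translate of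
    [f] is within [e / 4] of the same translate of [g]. *)
Lemma colourable_approx f : bm f ->
  (forall e : R, 0 < e -> exists g, [/\ bm g, colourable (rho g) &
    mean (fun x => `|f x - g x|) <= e]) ->
  colourable (rho f).
Proof.
move=> bf H e e0; have e4 : 0 < e / 4 by rewrite divr_gt0.
have [g [bg cg fg]] := H _ e4; have [T [c cP]] := cg _ (divr_gt0 e0 (ltr0n R 2)).
exists T, c => x y /cP gxy.
have bd : bm (fun x => `|f x - g x|) by apply/bm_norm/bmB.
apply: (@le_trans _ _ (mean (fun z => `|f (act x z) - g (act x z)| +
  (`|g (act x z) - g (act y z)| + `|f (act y z) - g (act y z)|)))).
  apply: le_mean; first exact: (bm_orbit_diff Hact).
    apply: bmD; first exact: (bm_act Hact _ bd).
    by apply: bmD; [exact: (bm_orbit_diff Hact)|exact: (bm_act Hact _ bd)].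
  move=> z; rewrite (distrC (f (act y z))).
  apply: (le_trans _ (lerD (lexx _) (ler_normD _ _))).
  apply: (le_trans _ (ler_normD _ _)).
  by rewrite le_eqVlt; apply/orP; left; apply/eqP; congr (`| _ |); ring.
rewrite !meanD; [|exact: (bm_orbit_diff Hact)|exact: (bm_act Hact _ bd)
  |exact: (bm_act Hact _ bd)
  |by apply: bmD; [exact: (bm_orbit_diff Hact)|exact: (bm_act Hact _ bd)]].
rewrite (mean_act Hact x bd) (mean_act Hact y bd).
rewrite -/(rho g x y); lra.
Qed.

(** Simple functions approximate [f] in L^1, and they are finite linear combinations of
    indicators. *)
Lemma colourable_bounded : (forall A, measurable A -> colourable (rho \1_A)) ->
  forall f, bm f -> colourable (rho f).
Proof.
move=> H f bf; apply: colourable_approx => // e e0.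
have [s [_ _ sf]] := approximation_sfun_integrable measurableT (bm_integrable mu bf).
have bs n : bm (s n).
  split; first exact: measurable_funP.
  have /finite_fsetP[A AE] := @fimfunP _ _ (s n).
  exists (\sum_(y <- A) `|y|) => x.
  have xA : s n x \in A.
    have : range (s n) (s n x) by exists x.
    by rewrite AE.
  by rewrite (big_fsetD1 (s n x))//= lerDl sumr_ge0.
have [N _ HN] := (cvgrPdist_le _ _).1 (fine_cvg sf) _ e0.
exists (s N); split => //.
  rewrite (_ : (s N : X -> R) = fun x => \sum_(y <- fset_set (range (s N)))
      y * \1_(s N @^-1` [set y]) x); last first.
    by apply/funext => x; rewrite [LHS]fimfunE fsbig_finite//; exact: fimfunP.
  have mS y : measurable (s N @^-1` [set y]).
    exact: measurable_sfunP.
  apply: colourable_sum => y; first by apply: bmM; [exact: bm_cst|exact: bm_indic].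
  by apply: colourableZ; [exact: bm_indic|exact: H].
have := HN N (leqnn N); rewrite sub0r normrN /= => h.
by apply: le_trans h; exact: ler_norm.
Qed.


(** Dominated convergence with majorant [f ^ 2]; at each point the integrand is eventually zero. *)
Lemma truncation_cvg (f : X -> R) : measurable_fun setT f ->
  mu.-integrable setT (fun x => (f x ^+ 2)%:E) ->
  (\int[mu]_x ((f x - f x * \1_[set y | `|f y| <= n%:R] x) ^+ 2)%:E)%E
    @[n --> \oo] --> 0%E.
Proof.
move=> mf if2.
have mS (n : nat) : measurable [set y | `|f y| <= n%:R].
  rewrite (_ : [set y | _] = (fun y => `|f y|) @^-1` `]-oo, n%:R]); last first.
    by apply/seteqP; split => x /=; rewrite in_itv.
  by rewrite -[_ @^-1` _]setTI; apply: measurableT_comp.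
have -> : 0%E = (\int[mu]_x (cst 0%E x))%E :> \bar R by rewrite integral0.
apply: (@dominated_cvg _ _ _ mu setT measurableT
  (fun n x => ((f x - f x * \1_[set y | `|f y| <= n%:R] x) ^+ 2)%:E) _
  (fun x => (f x ^+ 2)%:E)) => //.
- move=> n; apply/measurable_EFinP; apply: measurable_funX.
  by apply: measurable_funB => //; apply: measurable_funM => //; exact: measurable_indic.
- move=> x _; apply: cvg_near_cst.
  exists (Num.truncn `|f x|).+1 => // n /= xn.
  rewrite indicE mem_set ?mulr1 ?subrr ?expr0n//=.
  by apply/ltW/(lt_le_trans (truncnS_gt _)); rewrite ler_nat.
- move=> n x _; rewrite abse_EFin lee_fin ger0_norm ?sqr_ge0//.
  rewrite indicE; case: (_ \in _); first by rewrite mulr1 subrr expr0n sqr_ge0.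
  by rewrite mulr0 subr0.
Qed.

Lemma sqr_sum3_le (a b c : R) : (a + b + c) ^+ 2 <= 3 * (a ^+ 2 + b ^+ 2) + 3 * c ^+ 2.
Proof.
have := sqr_ge0 (a - b); have := sqr_ge0 (a - c); have := sqr_ge0 (b - c).
rewrite !expr2; nra.
Qed.

(** The function [f] is replaced by a truncation [r] bounded by [N]. The two tails cost at most
    [eps ^ 2 / 2] by invariance. For [r], the bound [D ^ 2 <= 2 N D] on the difference [D] of two
    translates lets L^1 closeness give L^2 closeness. *)
Lemma colourable_discrete_spectrum :
  (forall A, measurable A -> colourable (rho \1_A)) -> discrete_spectrum mu act.
Proof.
move=> H f mf if2 eps eps0.
have d0 : 0 < eps ^+ 2 / 12 by rewrite divr_gt0// exprn_gt0.
have /fine_cvgP[fin_near cv] := truncation_cvg mf if2.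
have [N1 _ HN1] := fin_near.
have [N2 _ HN2] := (cvgrPdist_le _ _).1 cv _ d0.
pose N := maxn N1 N2; pose S := [set y | `|f y| <= N%:R].
pose r x := f x * \1_S x.
have mS : measurable S.
  rewrite (_ : S = (fun y => `|f y|) @^-1` `]-oo, N%:R]); last first.
    by apply/seteqP; split => x /=; rewrite in_itv.
  by rewrite -[_ @^-1` _]setTI; apply: measurableT_comp.
have rN x : `|r x| <= N%:R.
  rewrite /r indicE; have [|_] := boolP (x \in S); last by rewrite mulr0 normr0.
  by rewrite inE mulr1.
have br : bm r.
  split; last by exists N%:R.
  by apply: measurable_funM => //; exact: measurable_indic.
have mq : measurable_fun setT (fun x => ((f x - r x) ^+ 2)%:E).
  apply/measurable_EFinP; apply: measurable_funX.
  by apply: measurable_funB => //; case: br.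
have q0 x : (0 <= ((f x - r x) ^+ 2)%:E)%E by rewrite lee_fin sqr_ge0.
have Iq : (\int[mu]_x ((f x - r x) ^+ 2)%:E <= (eps ^+ 2 / 12)%:E)%E.
  have := HN2 N (leq_maxr _ _); rewrite /= sub0r normrN => h.
  rewrite -(fineK (HN1 N (leq_maxl _ _))) lee_fin.
  by apply: le_trans h; exact: ler_norm.
(* With this radius the middle term [6 N D] has mean at most [eps ^ 2 / 2]; the successor keeps the
   denominator nonzero when [N] is 0. *)
have k0 : 0 < eps ^+ 2 / (12 * N.+1%:R).
  by rewrite divr_gt0 ?exprn_gt0// mulr_gt0.
have [m [s sP]] := colourable_net (colourable_bounded H br) k0.
exists [seq s i | i <- enum 'I_m] => g; have [i gi] := sP g.
exists (s i); first by apply/mapP; exists i; rewrite ?mem_enum.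
set h := s i in gi *.
pose D x := `|r (act g x) - r (act h x)|.
have bD : bm D by exact: (bm_orbit_diff Hact br).
have mqg a : measurable_fun setT (fun x => ((f (act a x) - r (act a x)) ^+ 2)%:E).
  exact: (measurableT_comp mq (measurable_act Hact a)).
have mqq : measurable_fun setT (fun x => (((f (act g x) - r (act g x)) ^+ 2)%:E
   + ((f (act h x) - r (act h x)) ^+ 2)%:E)%E).
  exact: emeasurable_funD.
have mD6 : measurable_fun setT (fun x => (6 * N%:R * D x)%:E).
  by apply/measurable_EFinP; have [] := bmM (bm_cst (6 * N%:R)) bD.
apply: (@le_trans _ _ (\int[mu]_x (((3 : R)%:E * (((f (act g x) - r (act g x)) ^+ 2)%:E
   + ((f (act h x) - r (act h x)) ^+ 2)%:E)) + (6 * N%:R * D x)%:E))%E).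
  apply: ge0_le_integral => //.
  - by move=> x _; rewrite lee_fin sqr_ge0.
  - apply/measurable_EFinP; apply: measurable_funX; apply: measurable_funB;
    exact: measurableT_comp mf (measurable_act Hact _).
  - by apply: emeasurable_funD => //; exact: measurable_funeM.
  - move=> x _; rewrite -[leRHS]/((3 * ((f (act g x) - r (act g x)) ^+ 2
      + (f (act h x) - r (act h x)) ^+ 2) + 6 * N%:R * D x)%:E) lee_fin.
    apply: (le_trans _ (le_trans (sqr_sum3_le (f (act g x) - r (act g x))
      (- (f (act h x) - r (act h x))) (r (act g x) - r (act h x))) _)).
      by rewrite le_eqVlt; apply/orP; left; apply/eqP; congr (_ ^+ _); ring.
    rewrite sqrrN lerD2l -real_normK ?num_real// -/(D x) expr2.
    rewrite -subr_ge0 (_ : _ - _ = 3 * D x * (2 * N%:R - D x)); last by ring.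
    apply: mulr_ge0; first by rewrite mulr_ge0// normr_ge0.
    rewrite subr_ge0 /D (le_trans (ler_normB _ _))//.
    by rewrite mulr_natl mulr2n lerD.
rewrite ge0_integralD//; last 3 first.
- move=> x _; apply: mule_ge0; first by rewrite lee_fin.
  by apply: adde_ge0; exact: q0.
- exact: measurable_funeM.
- by move=> x _; rewrite lee_fin mulr_ge0 ?mulr_ge0// normr_ge0.
rewrite ge0_integralZl//; last by move=> x _; apply: adde_ge0; exact: q0.
rewrite ge0_integralD//.
rewrite (integral_act Hact g mq q0) (integral_act Hact h mq q0).
rewrite -(EFin_mean mu (bmM (bm_cst (6 * N%:R)) bD)) meanZ//.
apply: (@le_trans _ _ ((3 : R)%:E * ((eps ^+ 2 / 12)%:E + (eps ^+ 2 / 12)%:E)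
  + (6 * N%:R * (eps ^+ 2 / (12 * N.+1%:R)))%:E)%E).
  apply: leeD; last by rewrite lee_fin ler_wpM2l// mulr_ge0.
  by apply: lee_wpmul2l; rewrite ?lee_fin//; exact: leeD.
rewrite -[leLHS]/((3 * (eps ^+ 2 / 12 + eps ^+ 2 / 12)
  + 6 * N%:R * (eps ^+ 2 / (12 * N.+1%:R)))%:E) lee_fin.
have -> : 6 * N%:R * (eps ^+ 2 / (12 * N.+1%:R)) = (eps ^+ 2 / 2) * (N%:R / N.+1%:R).
  have : (N.+1%:R : R) != 0 by rewrite pnatr_eq0.
  by set a := N.+1%:R => a0; field.
have : (N%:R / N.+1%:R : R) <= 1 by rewrite ler_pdivrMr// mul1r ler_nat.
have e2 : 0 < eps ^+ 2 by rewrite exprn_gt0.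
move=> h1; have : eps ^+ 2 / 2 * (N%:R / N.+1%:R) <= eps ^+ 2 / 2.
  by rewrite ler_piMr// divr_ge0// ltW.
move=> h2; apply: (le_trans (lerD (lexx _) h2)); move: (eps ^+ 2) => E.
by rewrite le_eqVlt; apply/orP; left; apply/eqP; field.
Qed.

End DiscreteSpectrum.

(** * Finite partitions as index functions *)

Section PartitionIndex.
Context {d : measure_display} {X : measurableType d} {R : realType}.
Variables (G : choiceType) (act : G -> X -> X).

Lemma partition_index k (A : 'I_k -> set X) : is_partition A ->
  exists t : X -> 'I_k, measurable_fibers t /\ forall i x, A i x <-> t x = i.
Proof.
move=> [mA [dA cA]].
have /choice[t tP] : forall x, exists i, A i x.
  by move=> x; have : setT x by []; rewrite -cA => -[i _ Aix]; exists i.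
have tE i x : A i x <-> t x = i.
  split=> [Aix|<-//]; apply/eqP; apply/negPn/negP => ti.
  have := dA _ _ ti; rewrite -subset0 => /(_ x); apply; split => //.
exists t; split=> // i; rewrite (_ : _ @^-1` _ = A i)//.
by apply/seteqP; split => x /= /tE.
Qed.

(** The form in which an arbitrary measurable set enters hypotheses about partitions with two
    atoms. *)
Definition dichotomy (B : set X) (i : 'I_2) : set X := if i == ord0 then B else ~` B.

Definition dichotomy_index (B : set X) (x : X) : 'I_2 :=
  if x \in B then ord0 else ord_max.

Lemma dichotomy_indexP B i x : dichotomy B i x <-> dichotomy_index B x = i.
Proof.
rewrite /dichotomy /dichotomy_index; case: (boolP (x \in B)) => [/set_mem xB|xB].
  case: eqP => [->|i0]; first by [].
  by split => [|/esym].
have {}xB : ~ B x by move=> ?; move/negP: xB; apply; exact: mem_set.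
case: eqP => [->|i0]; first by split.
split => // _; apply/val_inj; case: i i0 => [[|[|//]] p] //= i0.
by exfalso; apply: i0; apply/val_inj.
Qed.

Lemma is_partition_dichotomy B : measurable B -> is_partition (dichotomy B).
Proof.
move=> mB; split; first by move=> i; rewrite /dichotomy; case: ifP => // _; exact: measurableC.
split.
  move=> i j ij; apply/seteqP; split => // x [/dichotomy_indexP xi /dichotomy_indexP xj].
  by move: ij; rewrite -xi -xj eqxx.
apply/seteqP; split => // x _.
by exists (dichotomy_index B x) => //; apply/dichotomy_indexP.
Qed.

Lemma sep_index k (A : 'I_k -> set X) (t : X -> 'I_k) :
  (forall i x, A i x <-> t x = i) ->
  forall g x y, `[< sep act A g x y >] = (t (act g x) != t (act g y)).
Proof.
move=> tE g x y; apply/asboolP/idP => [[i [/tE xi nyi]]|ne].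
  by apply/eqP => xy; apply: nyi; apply/tE; rewrite -xy.
exists (t (act g x)); split; first exact/tE.
by move=> /tE /esym /eqP; apply/negP.
Qed.

Lemma Hdist_sum k (A : 'I_k -> set X) (t : X -> 'I_k) (S : {fset G}) x y :
  (forall i x, A i x <-> t x = i) ->
  Hdist R act A S x y
    = (\sum_(g <- S) (t (act g x) != t (act g y))%:R) / #|` S|%:R.
Proof.
move=> tE; rewrite /Hdist card_filter_fset; congr (_ / _).
by apply: eq_bigr => g _; rewrite (sep_index tE).
Qed.

Lemma measurable_Hball k (A : 'I_k -> set X) (S : {fset G}) x (e : R) :
  is_partition A -> (forall g, measurable_fun setT (act g)) ->
  measurable (Hball act A S x e).
Proof.
move=> /partition_index[t [mt tE]] mact.
rewrite (_ : Hball _ _ _ _ _ = (fun y =>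
   (\sum_(g <- S) (t (act g x) != t (act g y))%:R) / #|` S|%:R) @^-1` `]-oo, e[).
  rewrite -[_ @^-1` _]setTI.
  have [m _] : bounded_measurable (fun y =>
     (\sum_(g <- S) (t (act g x) != t (act g y))%:R : R) / #|` S|%:R).
    apply: bmM; last exact: bm_cst.
    apply: bm_sum => g; apply: (@bm_fibers _ _ _ _ (fun y => t (act g y))
      (fun i => (t (act g x) != i)%:R)) => i.
    by rewrite -[_ @^-1` _]setTI; exact: (mact g _ _ (mt i)).
  exact: m.
by apply/seteqP; split => y /=; rewrite in_itv /= /Hball /= (Hdist_sum _ _ _ tE).
Qed.

End PartitionIndex.

(** * Bounded complexity *)

Section LimSup.
Variable R : realType.
Implicit Types (u : nat -> \bar R) (c : \bar R).

Lemma limn_esup_le u c N : (forall n, (N <= n)%N -> (u n <= c)%E) ->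
  (limn_esup u <= c)%E.
Proof.
move=> uc; apply: (@le_trans _ _ (ereal_sup (u @` [set n | (N <= n)%N]))).
  apply: ereal_inf_lbound; exists [set n | (N <= n)%N] => //=.
  by exists N.
by apply: ge_ereal_sup => _ [n /= Nn <-]; exact: uc.
Qed.

Lemma limn_esup_lt u c : (limn_esup u < c)%E ->
  exists N, forall n, (N <= n)%N -> (u n < c)%E.
Proof.
move=> /ereal_inf_lt[_ [A [N _ NA] <-] Ac].
exists N => n Nn; apply: le_lt_trans Ac.
by apply: ereal_sup_ubound; exists n => //; exact: NA.
Qed.

Lemma limn_esup_ge u c : (forall N, exists2 n, (N <= n)%N & (c <= u n)%E) ->
  (c <= limn_esup u)%E.
Proof.
move=> H; apply: le_ereal_inf_tmp => _ [A [N _ NA] <-].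
have [n Nn cn] := H N; apply: le_trans cn _.
by apply: ereal_sup_ubound; exists n => //; exact: NA.
Qed.

End LimSup.

Section Complexity.
Context {d : measure_display} {X : measurableType d} {R : realType}.
Variables (mu : probability X R) (G : choiceType) (L : group_law G).
Variable act : G -> X -> X.
Hypothesis Hact : mp_action mu L act.
Local Notation bm := (@bounded_measurable d X R).
Local Notation mfib := measurable_fibers.
Local Notation mean := (mean mu).
Local Notation rho := (orbit_dist mu act).
Local Notation colourable := (@finitely_colourable R G).

Lemma probability_point : exists x : X, True.
Proof.
apply: contrapT => no; have : mu setT = 0%E.
  rewrite (_ : setT = set0) ?measure0//.
  by apply/seteqP; split => // x _; apply: no; exists x.
by rewrite probability_setT => /eqP; rewrite onee_eq0.
Qed.

Lemma complexity_le_mono k (A : 'I_k -> set X) S (e : R) C C' : (C <= C')%N ->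
  complexity_le mu act A S e C -> complexity_le mu act A S e C'.
Proof. by move=> CC' [m [D [mC H]]]; exists m, D; split=> //; exact: leq_trans CC'. Qed.

(** One centre in [V] is chosen for each name occurring there, and a point of [V] lies in the ball
    around the centre that shares its name. Names that do not occur in [V] get an arbitrary point
    [x0]. *)
Lemma complexity_of_names k (A : 'I_k -> set X) (S : {fset G}) (e : R)
    (T : finType) (n : X -> T) (V : set X) :
  is_partition A -> measurable V -> 1 - e < pr mu V ->
  (forall x y, V x -> V y -> n x = n y -> Hdist R act A S x y < e) ->
  complexity_le mu act A S e #|T|.
Proof.
move=> pA mV eV nV; have [x0 _] := probability_point.
have /choice[r rP] : forall v : T, exists x,
    (exists y, V y /\ n y = v) -> V x /\ n x = v.
  move=> v; have [[y yv]|no] := pselect (exists y, V y /\ n y = v).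
    by exists y.
  by exists x0.
exists #|T|, (fun i => r (enum_val i)); split => //.
have mU : measurable (\bigcup_(i in [set: 'I_#|T|])
    Hball act A S (r (enum_val i)) e).
  apply: fin_bigcup_measurable; first exact: finite_finset.
  by move=> i _; apply: measurable_Hball => // g; exact: (measurable_act Hact).
rewrite (mu_pr mu mU) lte_fin; apply: (lt_le_trans eV).
apply: le_pr => // y Vy; exists (enum_rank (n y)) => //.
rewrite enum_rankK /Hball /=.
have [Vr nr] := rP (n y) (ex_intro _ y (conj Vy erefl)).
exact: nV.
Qed.

Lemma complexity_trivial k (A : 'I_k -> set X) (S : {fset G}) (e : R) :
  is_partition A -> 0 < e -> exists C, complexity_le mu act A S e C.
Proof.
move=> pA e0; have [t [mt tE]] := partition_index pA.
exists #|{ffun S -> 'I_k}|.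
apply: (@complexity_of_names _ _ _ _ _
  (fun x => [ffun g : S => t (act (val g) x)]) setT) => //.
  by rewrite prT ltrBlDr ltrDl.
move=> x y _ _ /ffunP xy; rewrite (Hdist_sum _ _ _ _ tE) big_seq big1 ?mul0r// => g gS.
by have := xy [` gS]%fset; rewrite !ffunE /= => ->; rewrite eqxx.
Qed.

Lemma neq_le_natr_dist k (i j : 'I_k) : ((i != j)%:R : R) <= `|i%:R - j%:R|.
Proof.
case: (eqVneq i j) => [_|ij] /=; first exact: normr_ge0.
wlog lt : i j ij / (j < i)%N.
  move=> W; have := ij; rewrite -val_eqE neq_ltn => /orP[|] lt.
    by rewrite distrC W// eq_sym.
  exact: W.
rewrite -(natrB _ (ltnW lt)) normr_nat.
by rewrite (ler_nat R 1) subn_gt0.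
Qed.

(** Points are named by their letters along a finite net, so the number of names does not depend on
    [S]. The function [M] is the proportion of [g] in [S] at which the net predicts the letter
    wrongly; two points with equal names satisfy [Hdist <= M x + M y]. As [M] has mean at most
    [e ^ 2 / 8], Markov's inequality at level [e / 2] discards measure at most [e / 4]. *)
Lemma colourable_bmc k (A : 'I_k -> set X) (t : X -> 'I_k) :
  is_partition A -> mfib t -> (forall i x, A i x <-> t x = i) ->
  colourable (rho (fun x => (t x)%:R)) -> bmc_along_G mu act A.
Proof.
move=> pA mt tE ct e e0.
have e28 : 0 < e ^+ 2 / 8 by rewrite divr_gt0// exprn_gt0.
have [m [s /choice[c cP]]] := colourable_net ct e28.
exists #|{ffun 'I_m -> 'I_k}| => S S0.
have cS : 0 < (#|` S|%:R : R) by rewrite ltr0n cardfs_gt0.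
pose mis g h x : R := (t (act g x) != t (act h x))%:R.
have bmis g h : bm (mis g h).
  apply: (@bm_fibers _ _ _ _ (fun x => (t (act g x), t (act h x)))
    (fun p => (p.1 != p.2)%:R)).
  by apply: measurable_fibers_pair; exact: (measurable_fibers_act Hact).
pose M x := #|` S|%:R^-1 * \sum_(g <- S) mis g (s (c g)) x.
have bS : bm (fun x => \sum_(g <- S) mis g (s (c g)) x) by exact: bm_sum.
have bM : bm M by apply: bmM => //; exact: bm_cst.
have M0 x : 0 <= M x by rewrite mulr_ge0 ?invr_ge0// sumr_ge0.
have meanM : mean M <= e ^+ 2 / 8.
  rewrite meanZ// mean_sum// mulrC ler_pdivrMr// -sum_cst_fset.
  apply: ler_sum => g _; apply: le_trans (cP g).
  have bt : bm (fun x => (t x)%:R).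
    exact: (@bm_fibers _ _ _ _ t (fun i : 'I_k => (i : nat)%:R)).
  apply: le_mean => //; first exact: (bm_orbit_diff Hact bt).
  by move=> x; exact: neq_le_natr_dist.
have [mV prV] := markov_mean (l := e / 2) mu bM M0 (divr_gt0 e0 (ltr0n R 2)).
apply: (@complexity_of_names _ _ _ _ _
  (fun x => [ffun i : 'I_m => t (act (s i) x)]) (~` [set x | e / 2 <= M x])) => //.
- exact: measurableC.
- rewrite prC// ltrD2l ltrN2.
  have h := le_trans prV meanM.
  rewrite -(ltr_pM2l (divr_gt0 e0 (ltr0n R 2))); apply: le_lt_trans h _.
  by rewrite expr2; nra.
- move=> x y /= /negP; rewrite -ltNge => Mx /negP; rewrite -ltNge => My /ffunP xy.
  rewrite (Hdist_sum _ _ _ _ tE) mulrC.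
  apply: (@le_lt_trans _ _ (M x + M y)); last by rewrite [e]splitr ltrD.
  rewrite -mulrDr ler_wpM2l ?invr_ge0// -big_split /=.
  (* If the letters of [x] and [y] at [g] differ, at least one of them differs from the common
     letter [z] at the net point. *)
  apply: ler_sum => g _; rewrite /mis; have := xy (c g); rewrite !ffunE => ->.
  set a := t _; set b := t _; set z := t _.
  case: (eqVneq a z) => [->|_]; first by rewrite add0r eq_sym.
  by rewrite -{1}[_%:R]addr0 lerD// lern1 leq_b1.
Qed.

(** The set [V N] collects the points of each [B i] that are close to the representative [r i] for
    all indices from [N] on. These sets increase to the union of the [B i], so continuity from below
    provides one [N] for which [m] balls suffice at all later indices. The finitely many earlier
    indices are covered by [complexity_trivial]. *)
Lemma mean_equicont_bmc k (A : 'I_k -> set X) (F : nat -> {fset G}) :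
  is_partition A -> mean_equicont mu act A F -> bmc_wrt mu act A F.
Proof.
move=> pA H e e0; have [m [B [mB [_ [muB HB]]]]] := H e e0.
have [x0 _] := probability_point.
have /choice[r rP] : forall i, exists x, (exists y, B i y) -> B i x.
  move=> i; have [[y yB]|no] := pselect (exists y, B i y); first by exists y.
  by exists x0.
have mHb S x : measurable (Hball act A S x e).
  by apply: measurable_Hball => // g; exact: (measurable_act Hact).
pose V N := \bigcup_(i in [set: 'I_m])
  (B i `&` \bigcap_(n in [set n | (N <= n)%N]) Hball act A (F n) (r i) e).
have mV N : measurable (V N).
  apply: fin_bigcup_measurable; first exact: finite_finset.
  by move=> i _; apply: measurableI => //; apply: bigcap_measurable => //; exists N => /=.
have VE : \bigcup_N V N = \bigcup_(i in [set: 'I_m]) B i.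
  apply/seteqP; split => [x [N _ [i _ [Bx _]]]|x [i _ Bx]]; first by exists i.
  have Br := rP i (ex_intro _ x Bx).
  have [N NP] := limn_esup_lt (HB i _ _ Br Bx).
  exists N => //; exists i => //; split=> // n /NP.
have mUV : measurable (\bigcup_N V N) by exact: bigcup_measurable.
have [N NV] : exists N, ((1 - e)%:E < mu (V N))%E.
  apply: contrapT => no.
  have cv : (mu \o V) @ \oo --> mu (\bigcup_N V N).
    apply: nondecreasing_cvg_mu => // a b ab; apply/subsetPset => x [i _ [Bx Vx]].
    by exists i => //; split => // n /= bn; apply: Vx; exact: leq_trans bn.
  move: muB; rewrite -VE ltNge => /negP; apply.
  rewrite -(cvg_lim _ cv)//; apply: lime_le; first by apply/cvg_ex; eexists; exact: cv.
  by apply: nearW => n; rewrite leNgt; apply/negP => h; apply: no; exists n.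
have /choice[C CP] : forall n, exists C, complexity_le mu act A (F n) e C.
  by move=> n; exact: complexity_trivial.
exists (m + \sum_(n < N) C n)%N => n; have [nN|Nn] := ltnP n N.
  apply: complexity_le_mono (CP n).
  by rewrite (bigD1 (Ordinal nN)) //= addnCA leq_addr.
apply: (@complexity_le_mono _ _ _ _ m); first exact: leq_addr.
exists m, r; split => //; apply: (lt_le_trans NV); apply: le_measure.
- by rewrite inE.
- by rewrite inE; apply: fin_bigcup_measurable => //; exact: finite_finset.
- by move=> x [i _ [_ Vx]]; exists i => //; exact: Vx.
Qed.

End Complexity.

(** * From bounded complexity to total boundedness *)

Section BoundedComplexity.
Context {d : measure_display} {X : measurableType d} {R : realType}.
Variables (mu : probability X R) (G : choiceType) (L : group_law G).
Variable act : G -> X -> X.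
Hypothesis Hact : mp_action mu L act.
Local Notation bm := (@bounded_measurable d X R).
Local Notation mfib := measurable_fibers.
Local Notation mean := (mean mu).
Local Notation rho := (orbit_dist mu act).
Local Notation colourable := (@finitely_colourable R G).
Local Notation "a ** b" := (gmul L a b) (at level 40, left associativity).

(** Greedy choice: a finite sequence that is not a net can be extended by a point far from all its
    members. *)
Lemma separated_seq (dist : G -> G -> R) (e : R) :
  ~ (exists (m : nat) (s : 'I_m -> G), forall g, exists i, dist g (s i) <= e) ->
  forall N, exists2 s : seq G, size s = N & pairwise (fun g h => e < dist g h) s.
Proof.
move=> no; elim=> [|N [s sN ps]]; first by exists [::].
have [g gP] : exists g, forall i : 'I_(size s), e < dist g (tnth (in_tuple s) i).
  apply: contrapT => nog; apply: no; exists (size s), (tnth (in_tuple s)) => g.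
  apply: contrapT => nogi; apply: nog; exists g => i.
  by rewrite ltNge; apply/negP => gi; apply: nogi; exists i.
exists (g :: s); rewrite /= ?sN// ps andbT; apply/allP => h hs.
have hi : (index h s < size s)%N by rewrite index_mem.
by have := gP (Ordinal hi); rewrite (tnth_nth g) /= nth_index.
Qed.

(** If [h g] and [h' g] both lay in the ball of radius [e / 2] around [g0], then [h] and [h'] would
    be within [e] by right invariance. Thus the translates of this ball by the inverses of the
    members of [s] are disjoint. *)
Lemma card_separated_near f (s : seq G) (e : R) g0 : bm f ->
  pairwise (fun g h => e < rho f g h) s ->
  forall g, \sum_(h <- s) ((rho f (h ** g) g0 <= e / 2)%R%:R : R) <= 1.
Proof.
move=> bf + g; elim: s => [|h s IH] /=; first by rewrite big_nil.
move=> /andP[/allP hs /IH ps]; rewrite big_cons.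
have [hg|_] := boolP (rho f (h ** g) g0 <= e / 2); last by rewrite add0r.
rewrite big_seq big1 ?addr0// => h' h's; apply/eqP; rewrite pnatr_eq0 eqb0.
apply/negP => h'g; have := hs _ h's; rewrite ltNge => /negP; apply.
rewrite -(orbit_distMr Hact bf h h' g).
apply: le_trans (orbit_dist_triangle Hact bf _ g0 _) _.
by rewrite [leRHS]splitr lerD// orbit_distC.
Qed.

Section NameClasses.
Variables (B : set X) (mB : measurable B).
Local Notation A := (dichotomy B).
Let f : X -> R := \1_B.

(* Elements of [F] whose translates of [B] are well approximated by unions of
   balls get a colour (the names of the centres), so one colour class is large. *)
Lemma complexity_le_ball (F : {fset G}) (e : R) C : 0 < e -> F != fset0 ->
  complexity_le mu act A F e C ->
  exists g0, #|` F|%:R / (2 * 2 ^+ C) <=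
    \sum_(g <- F) ((rho f g g0 <= 8 * e)%R%:R : R).
Proof.
move=> e0 F0 [m [D [mC muD]]].
have cF : 0 < (#|` F|%:R : R) by rewrite ltr0n cardfs_gt0.
have bf : bm f by exact: bm_indic.
have pA : is_partition A by exact: is_partition_dichotomy.
have HE y x : Hdist R act A F x y =
    (\sum_(g <- F) `|f (act g y) - f (act g x)|) / #|` F|%:R.
  rewrite (Hdist_sum _ _ _ _ (dichotomy_indexP B)); congr (_ / _).
  apply: eq_bigr => g _; rewrite /f !indicE /dichotomy_index.
  by case: (act g x \in B); case: (act g y \in B);
    rewrite -val_eqE /= ?subrr ?subr0 ?sub0r ?normrN ?normr0 ?normr1.
have mHb i : measurable (Hball act A F (D i) e).
  by apply: measurable_Hball => // g; exact: (measurable_act Hact).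
pose tau x : option 'I_m := [pick i | x \in Hball act A F (D i) e].
have mtau : mfib tau.
  have := measurable_fibers_comp (fun v : {ffun 'I_m -> bool} => [pick i | v i])
    (measurable_fibers_ffun (fun i => measurable_fibers_bool (mHb i))).
  rewrite (_ : (fun x => _) = tau)// funeqE => x.
  by apply: eq_pick => i; rewrite ffunE.
(* The error of replacing the translate of [f] by its value at the centre of the ball chosen for
   [x]; outside all balls it is 1, the largest possible difference. *)
pose E g (x : X) : R := if tau x is Some i then `|f (act g x) - f (act g (D i))| else 1.
have bE g : bm (E g).
  apply: (@bm_fibers _ _ _ _ (fun x => (tau x, act g x \in B))
    (fun p => if p.1 is Some i then `|p.2%:R - f (act g (D i))| else 1)).
  apply: measurable_fibers_pair => //.
  exact: (measurable_fibers_act Hact g (measurable_fibers_bool mB)).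
have mU : measurable (\bigcup_(i in [set: 'I_m]) Hball act A F (D i) e).
  by apply: fin_bigcup_measurable => //; exact: finite_finset.
set U := \bigcup_(i in _) _ in muD mU.
have sumE x : \sum_(g <- F) E g x <= #|` F|%:R * (e + \1_(~` U) x).
  rewrite /E /tau; case: pickP => [i xi|noi].
    rewrite mulrDr -[leLHS]addr0; apply: lerD; last exact: mulr_ge0.
    by move: xi; rewrite inE /Hball /= HE ltr_pdivrMr// mulrC => /ltW.
  rewrite sum_cst_fset mul1r ler_peMr// indicE mem_set ?lerDr ?ltW//.
  by move=> [i _ xi]; have := noi i; rewrite mem_set.
have meanE : \sum_(g <- F) mean (E g) <= #|` F|%:R * (2 * e).
  rewrite -mean_sum//; have mUc := measurableC mU.
  have b1 : bm (fun x => e + \1_(~` U) x).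
    by apply: bmD; [exact: bm_cst|exact: bm_indic].
  apply: (@le_trans _ _ (mean (fun x => #|` F|%:R * (e + \1_(~` U) x)))).
    apply: le_mean => //; first exact: bm_sum.
    by apply: bmM => //; exact: bm_cst.
  rewrite meanZ// meanD; [|exact: bm_cst|exact: bm_indic].
  rewrite mean_cst mean_indic// ler_pM2l// mulr_natl mulr2n lerD2l prC//.
  by move: muD; rewrite mu_pr// lte_fin => /ltW; rewrite lerBlDr lerBlDl addrC.
pose nm g : {ffun 'I_m -> bool} := [ffun i => act g (D i) \in B].
(* With equal names at the centres, both translates are compared with the same approximating
   value. *)
have rhoE g h : nm g = nm h -> rho f g h <= mean (E g) + mean (E h).
  move=> /ffunP gh; rewrite -meanD//; apply: le_mean.
  - exact: (bm_orbit_diff Hact bf).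
  - exact: bmD.
  move=> x; rewrite /E; case: (tau x) => [i|].
    have := gh i; rewrite !ffunE /f !indicE => ->.
    by rewrite (distrC ((act h x \in B)%:R)) (le_trans _ (ler_normD _ _))// addrA subrK.
  rewrite /f !indicE; case: (_ \in _); case: (_ \in _);
    rewrite ?subrr ?subr0 ?sub0r ?normrN ?normr0 ?normr1; lra.
(* The errors average to at most [2 * e] over [F], so by Markov's inequality at least half of [F] is
   good. *)
pose good g := mean (E g) <= 4 * e.
have goodF : #|` F|%:R / 2 <= \sum_(g <- F) ((good g)%:R : R).
  have : 4 * e * (#|` F|%:R - \sum_(g <- F) (good g)%:R) <= #|` F|%:R * (2 * e).
    apply: le_trans meanE; rewrite card_sum_fset -sumrB mulr_sumr.
    apply: ler_sum => g _; rewrite /good; have [_|/ltW h] := leP (mean (E g)) (4 * e).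
      rewrite /= subrr mulr0; apply: mean_ge0 => x; rewrite /E.
      by case: (tau x).
    by rewrite /= subr0 mulr1.
  set q := \sum_(g <- F) _ => h.
  rewrite -(ler_pM2l e0); lra.
(* Pigeonhole: the good elements share at most [2 ^ C] names. *)
have [v vP] : exists v, #|` F|%:R / (2 * 2 ^+ C) <=
    \sum_(g <- F) ((good g && (nm g == v))%:R : R).
  apply: contrapT => no.
  have : \sum_(v : {ffun 'I_m -> bool})
      \sum_(g <- F) ((good g && (nm g == v))%:R : R) < #|` F|%:R / 2.
    apply: (@lt_le_trans _ _ (\sum_(v : {ffun 'I_m -> bool}) #|` F|%:R / (2 * 2 ^+ C))).
      apply: ltr_sum; first by apply/hasP; exists [ffun=> false]; rewrite ?mem_index_enum.
      by move=> v _; rewrite ltNge; apply/negP => h; apply: no; exists v.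
    rewrite sumr_const card_ffun card_bool card_ord -[_ *+ (2 ^ m)]mulr_natl natrX.
    have p0 : (0 : R) < 2 ^+ C by rewrite exprn_gt0.
    rewrite [leLHS]mulrC -mulrA ler_wpM2l// [leLHS]mulrC ler_pdivrMr ?mulr_gt0//.
    by rewrite mulrA mulVf ?mul1r ?ler_weXn2l// ?ler1n// pnatr_eq0.
  rewrite exchange_big /= ltNge => /negP; apply.
  apply: (le_trans goodF); apply: ler_sum => g _.
  by rewrite (bigD1 (nm g)) //= eqxx andbT lerDl sumr_ge0.
have [g0 /andP[g0g /eqP g0v]] : exists g0, good g0 && (nm g0 == v).
  apply: contrapT => no; move: vP; rewrite big1; last first.
    by move=> g _; case: (boolP (_ && _)) => // h; exfalso; apply: no; exists g.
  by rewrite leNgt divr_gt0// mulr_gt0// exprn_gt0.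
exists g0; apply: (le_trans vP); apply: ler_sum => g _.
have [/andP[gg /eqP gv]|_] := boolP (_ && _); last exact: ler0n.
have -> // : rho f g g0 <= 8 * e.
apply: le_trans (rhoE g g0 _) _; first by rewrite gv g0v.
by move: gg g0g; rewrite /good; lra.
Qed.

(** A ball meets [F n] in proportion at least [c]. By the Folner property its translates by the
    members of a separated family keep proportion [c / 2]; being disjoint, there are at most [2 / c]
    of them. *)
Lemma bmc_colourable (F : nat -> {fset G}) : @folner G L F R ->
  bmc_wrt mu act A F -> colourable (rho f).
Proof.
move=> FF bF; have bf : bm f by exact: bm_indic.
apply: net_colourable; [exact: orbit_distC|by move=> *; exact: (orbit_dist_triangle Hact)|].
move=> e e0; apply: contrapT => /separated_seq sep.
(* The ball provided by [complexity_le_ball] has radius 8 times its input, hence [e / 2] here, as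
   [card_separated_near] requires. *)
have e16 : 0 < e / 16 by rewrite divr_gt0.
have [C CP] := bF _ e16.
(* One more than [2 / c = 2 ^ (C + 2)] separated elements, for the density [c] below. *)
have [s sN ps] := sep (2 ^ (C + 2)).+1.
pose c : R := (2 * 2 ^+ C)^-1.
have c0 : 0 < c by rewrite invr_gt0 mulr_gt0// exprn_gt0.
have [n HF] := folner_small FF s (divr_gt0 c0 (ltr0n R 2)).
have cF := folner_gt0 n FF.
have [g0 g0P] := complexity_le_ball e16 (FF.1 n) (CP n).
rewrite (_ : 8 * (e / 16) = e / 2) in g0P; last by lra.
pose u g : R := (rho f g g0 <= e / 2)%R%:R.
have u1 g : `|u g| <= 1 by rewrite /u normr_nat lern1 leq_b1.
have shift g : g \in s -> c / 2 * #|` F n|%:R <= \sum_(k <- F n) u (g ** k).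
  move=> gs; have := sum_translate L g (F n) u1; rewrite mul1r.
  have := HF n (leqnn n) g gs; rewrite ler_norml => h1 /andP[h2 _].
  have : c * #|` F n|%:R <= \sum_(k <- F n) u k by rewrite mulrC.
  by move: h1 h2; rewrite /c -/(u _); lra.
have : \sum_(g <- s) c / 2 * #|` F n|%:R <= #|` F n|%:R.
  apply: (@le_trans _ _ (\sum_(g <- s) \sum_(k <- F n) u (g ** k))).
    by rewrite !big_seq; apply: ler_sum => g gs; exact: shift.
  rewrite exchange_big /= card_sum_fset; apply: ler_sum => k _.
  exact: card_separated_near.
rewrite big_const_seq iter_addr_0 count_predT sN.
rewrite -[_ *+ (2 ^ (C + 2)).+1]mulr_natl mulrA ger_pMl//.
rewrite leNgt => /negP; apply; rewrite -natr1 mulrDl natrX exprD /c.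
have p0 : (0 : R) < 2 ^+ C by rewrite exprn_gt0.
rewrite (_ : _ * _ = 1) ?ltrDl ?mul1r ?divr_gt0//.
by move: p0; move: (2 ^+ C) => p p0; field; rewrite gt_eqF.
Qed.

End NameClasses.
End BoundedComplexity.

(** * A maximal inequality for tempered Folner sequences *)

Section Tempered.
Variables (R : realType) (G : choiceType) (L : group_law G).
Local Open Scope fset_scope. Local Open Scope ring_scope.
Local Notation "a ** b" := (gmul L a b) (at level 40, left associativity).
Local Notation inv := (ginv L).
Local Notation boundary := (boundary R L).

Lemma folner_mul_setD (F : nat -> {fset G}) (U : {fset G}) : @folner G L F R ->
  forall e : R, 0 < e -> exists N, forall n, (N <= n)%N ->
    (#|` [fset a ** b | a in U, b in F n] `\` F n|%:R : R) <= e * #|` F n|%:R.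
Proof.
move=> FF e e0; have c0 : 0 < #|` U|%:R + 1 :> R by rewrite ltr_wpDl.
have [N HN] := folner_small FF U (divr_gt0 e0 c0).
exists N => n Nn; apply: le_trans (card_mul_setD _ _ _ _) _.
apply: (@le_trans _ _ (\sum_(a <- U) e / (#|` U|%:R + 1) * #|` F n|%:R)).
  by rewrite !big_seq; apply: ler_sum => a aU; exact: HN.
rewrite sum_cst_fset mulrAC ler_wpM2r// mulrAC ler_pdivrMr//.
by rewrite ler_pM2l// lerDl.
Qed.

(** The next index is so large that [F n] is nearly invariant under the inverses of the union [U] of
    the sets already chosen; then [U^-1 F n] has at most twice as many elements as [F n]. *)
Lemma tempered_subsequence (F : nat -> {fset G}) : @folner G L F R ->
  exists F', @folner G L F' R /\ @tempered G L F' R.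
Proof.
move=> FF; have [F0 FC] := FF.
(* The state holds the union of the sets chosen strictly before the current one, and the current
   index. *)
have step (s : {fset G} * nat) : exists s' : {fset G} * nat,
    [/\ s'.1 = s.1 `|` F s.2, (s.2 < s'.2)%N &
     (#|` [fset inv a ** b | a in s'.1, b in F s'.2]|%:R : R) <= 2 * #|` F s'.2|%:R].
  pose U := s.1 `|` F s.2.
  have [N HN] := folner_mul_setD [fset inv a | a in U] FF ltr01.
  exists (U, maxn N s.2.+1); split => //=; first exact: leq_maxr.
  set n := maxn N _; have := HN n (leq_maxl _ _); rewrite mul1r => h.
  rewrite mulr_natl mulr2n; apply: (le_trans _ (lerD (lexx _) h)).
  rewrite -natrD ler_nat -(cardfsID (F n)) leq_add//.
    by apply: fsubset_leq_card; apply/fsubsetP => z; rewrite inE => /andP[].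
  apply: fsubset_leq_card; apply/fsubsetP => z; rewrite !inE => /andP[-> /=].
  move=> /imfset2P[a /= aU [b /= bF ->]]; apply/imfset2P.
  by exists (inv a); [apply/imfsetP; exists a|exists b].
have [s [s0 sS]] := dependent_choice (fun s => cid (step s)) (fset0, 0%N).
have mono : forall n, (n <= (s n).2)%N.
  elim=> [|n IH] //; have [_ h _] := sS n; exact: leq_ltn_trans IH h.
exists (fun n => F (s n).2); split; first split => // g.
  have := FC g => /(cvg_comp (fun n => (s n).2)); apply.
  by apply/cvgnyPge => A; exists A => // n /= An; exact: leq_trans (mono n).
exists 2; split => // -[//|n] _.
have -> : \big[fsetU/fset0]_(i < n.+1) F (s i).2 = (s n.+1).1.
  elim: n => [|n IH].
    by rewrite big_ord_recr big_ord0 /=; have [-> _ _] := sS 0%N; rewrite s0.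
  by rewrite big_ord_recr /= IH; have [-> _ _] := sS n.+1.
by have [] := sS n.
Qed.

Lemma argmax_fset (S : {fset G}) (h : G -> R) : S != fset0 ->
  exists2 k, k \in S & forall k', k' \in S -> h k' <= h k.
Proof.
move=> /fset0Pn[k0 k0S].
case: (@arg_maxP _ _ _ [` k0S] xpredT (fun k : S => h (val k)) isT) => k _ kP.
by exists (val k); [exact: valP|move=> k' k'S; exact: (kP [` k'S] isT)].
Qed.

Lemma leq_card_inj (G' : choiceType) (f : G -> G') (S : {fset G}) (T : {fset G'}) :
  injective f -> (forall a, a \in S -> f a \in T) -> (#|` S| <= #|` T|)%N.
Proof.
move=> fI fST; rewrite -(card_imfset imfset_key (mem S) fI) fsubset_leq_card//.
by apply/fsubsetP => y /imfsetP[a /= aS ->]; exact: fST.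
Qed.

Section Cover.
Variables (F : nat -> {fset G}) (c : R) (A : {fset G}) (lev : G -> nat).
Hypothesis F0 : forall n, F n != fset0.
Hypothesis Fc : forall n, (1 <= n)%N ->
  (#|` [fset inv a ** b | a in \big[fsetU/fset0]_(i < n) F i, b in F n]|%:R : R)
    <= c * #|` F n|%:R.

(** Each centre [a] carries the translate [F (lev a) a]. The three notions express that [z] lies in
    it, that it meets the translate of [b], and the total weight of the translates through [z]. *)
Let covers a z := z ** inv a \in F (lev a).
Let meets a b := has (fun k => covers b (k ** a)) (F (lev a)).
Let load (p : G -> R) z := \sum_(a <- A | covers a z) p a.

Let cardF n : 0 < (#|` F n|%:R : R).
Proof. by rewrite ltr0n cardfs_gt0. Qed.

(* Levels are treated from high to low: a new centre gets the share of the
   capacity left over, on the fullest point of its translate, by higher levels. *)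
Lemma greedy_weights (N i j : nat) : (i + j = N)%N -> (forall a, a \in A -> (lev a < N)%N) ->
  exists p : G -> R, [/\ forall a, 0 <= p a,
    forall a, a \in A -> (lev a < i)%N -> p a = 0,
    forall z, load p z <= 1 &
    forall a, a \in A -> (i <= lev a)%N -> 1 <= p a * #|` F (lev a)|%:R
      + \sum_(b <- A | (lev a < lev b)%N && meets a b) p b].
Proof.
move=> + levN; elim: j i => [|j IH] i.
  rewrite addn0 => ->; exists (fun=> 0); split => //.
    by move=> z; rewrite /load big1.
  by move=> a /levN; rewrite ltnNge => /negbTE ->.
rewrite addnS -addSn => /IH[p [p0 plow pload pcov]].
have /choice[k kP] : forall a, exists k, k \in F i /\
    forall k', k' \in F i -> load p (k' ** a) <= load p (k ** a).
  by move=> a; have [k ? ?] := argmax_fset (fun k => load p (k ** a)) (F0 i); exists k.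
pose q a := if lev a == i then (1 - load p (k a ** a)) / #|` F i|%:R else p a.
have q0 a : 0 <= q a.
  by rewrite /q; case: ifP => // _; rewrite divr_ge0// subr_ge0.
have qhigh a : (i < lev a)%N -> q a = p a.
  by move=> ia; rewrite /q gtn_eqF.
exists q; split => //.
- move=> a aA ai; rewrite /q ltn_eqF// plow//; exact: ltnW.
- move=> z.
  (* A new centre whose translate contains [z] gets at most [w], because its reference point is at
     least as loaded as [z]. At most [|F i|] centres of level [i] have translates through [z], so
     the new load is at most 1. *)
  pose w := (1 - load p z) / #|` F i|%:R.
  have w0 : 0 <= w by rewrite divr_ge0// subr_ge0.
  apply: (@le_trans _ _ (\sum_(a <- A | covers a z) (p a + (lev a == i)%:R * w))).
    rewrite [load q z]/load [leLHS]big_seq_cond [leRHS]big_seq_cond.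
    apply: ler_sum => a /andP[aA az].
    rewrite /q; case: eqP => [ai|_]; last by rewrite mul0r addr0.
    rewrite plow ?ai// add0r mul1r ler_wpM2r ?invr_ge0// lerB//.
    have [_ /(_ (z ** inv a))] := kP a; rewrite gmulgKV; apply.
    by move: az; rewrite /covers ai.
  rewrite big_split /= -/(load p z) -mulr_suml.
  apply: (@le_trans _ _ (load p z + #|` F i|%:R * w)); last first.
    by rewrite mulrC mulfVK ?gt_eqF// addrC subrK.
  rewrite lerD2l ler_wpM2r//.
  apply: (@le_trans _ _ (#|` [fset a in A | z ** inv a \in F i]|%:R)).
    rewrite card_filter_fset big_mkcond; apply: ler_sum => a _.
    rewrite /covers; case: (eqVneq (lev a) i) => [->|_]; first by case: ifP.
    by case: ifP; rewrite ler0n.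
  rewrite ler_nat; apply: (@leq_card_inj _ (fun a => z ** inv a)).
    move=> a b /= h; have h' : inv a = inv b by exact: gmul_injl h.
    by rewrite -(ginvK L a) h' ginvK.
  by move=> a; rewrite !inE /= => /andP[].
- move=> a aA; rewrite leq_eqVlt => /orP[/eqP ia|ia]; last first.
    rewrite qhigh//; apply: le_trans (pcov a aA ia) _; rewrite lerD2l.
    rewrite big_mkcond [leRHS]big_mkcond; apply: ler_sum => b _.
    by case: ifP => // /andP[ab _]; rewrite qhigh// (ltn_trans ia).
  (* The first term is 1 minus the old load at [k a ** a]. That load comes only from translates
     through this point of level above [i], and these meet the translate of [a]. *)
  rewrite {1}/q -ia eqxx mulfVK ?gt_eqF// -lerBlDl opprB addrC subrK.
  rewrite /load big_mkcond [leRHS]big_mkcond; rewrite !big_seq; apply: ler_sum => b bA.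
  case: ifP => bz; last by case: ifP => _; rewrite ?q0.
  have [ib|bi] := ltnP i (lev b).
    rewrite qhigh// (_ : meets a b = true)//.
    by apply/hasP; exists (k a) => //; rewrite -ia; case: (kP a).
  by rewrite plow//= .
Qed.

(** Summing the greedy inequalities over [A], the weight of [b] is counted once for each centre [a]
    of lower level whose translate meets that of [b]. Such [a] satisfy [a b^-1] in
    [F_i^-1 F_(lev b)] for some [i < lev b], so there are at most [c |F (lev b)|] of them. *)
Lemma fractional_cover (N : nat) : 0 <= c -> (forall a, a \in A -> (lev a < N)%N) ->
  exists p : G -> R, [/\ forall a, 0 <= p a, forall z, load p z <= 1 &
    #|` A|%:R <= (1 + c) * \sum_(a <- A) p a * #|` F (lev a)|%:R].
Proof.
move=> c0 levN; have [p [p0 _ pload pcov]] := greedy_weights (add0n N) levN.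
exists p; split => //; rewrite mulrDl mul1r card_sum_fset.
apply: (@le_trans _ _ (\sum_(a <- A) (p a * #|` F (lev a)|%:R +
   \sum_(b <- A | (lev a < lev b)%N && meets a b) p b))).
  by rewrite !big_seq; apply: ler_sum => a aA; exact: pcov.
rewrite big_split /= lerD2l (exchange_big_dep xpredT) //= mulr_sumr.
apply: ler_sum => b _.
apply: (@le_trans _ _ (p b *
    #|` [fset a in A | (lev a < lev b)%N && meets a b]|%:R)).
  by rewrite card_filter_fset mulr_sumr big_mkcond; apply: ler_sum => a _;
    case: ifP => _; rewrite ?mulr1 ?mulr0.
rewrite mulrCA ler_wpM2l//.
have [->|[a0 a0P]] := fset_0Vmem [fset a in A | (lev a < lev b)%N && meets a b].
  by rewrite cardfs0 mulr_ge0// ltW.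
have b1 : (1 <= lev b)%N.
  by move: a0P; rewrite !inE /= => /andP[_ /andP[h _]]; exact: leq_ltn_trans h.
apply: le_trans (Fc b1).
rewrite ler_nat; apply: (@leq_card_inj _ (fun a => a ** inv b)).
  by move=> a a' /= h; exact: gmul_injr h.
move=> a; rewrite !inE /= => /andP[_ /andP[ab /hasP[k kF kb]]].
apply/imfset2P; exists k => /=.
  by apply/bigfcupP; exists (Ordinal ab); rewrite ?mem_index_enum.
exists (k ** a ** inv b) => //.
by rewrite -gmulA gmulKV.
Qed.

End Cover.
End Tempered.

(** * Transfer of the covering lemma to the action *)

Section MaximalInequality.
Context {d : measure_display} {X : measurableType d} {R : realType}.
Variables (mu : probability X R) (G : choiceType) (L : group_law G).
Variable act : G -> X -> X.
Hypothesis Hact : mp_action mu L act.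
Local Notation bm := (@bounded_measurable d X R).
Local Notation mean := (mean mu).
Local Notation "a ** b" := (gmul L a b) (at level 40, left associativity).
Local Notation inv := (ginv L).

Variables (F : nat -> {fset G}) (c : R).
Hypothesis FF : @folner G L F R.
Hypothesis c0 : 0 <= c.
Hypothesis Fc : forall n, (1 <= n)%N ->
  (#|` [fset gmul L (inv a) b | a in \big[fsetU/fset0]_(i < n) F i, b in F n]%fset|%:R : R)
    <= c * #|` F n|%:R.
Variables (v : X -> R) (l : R).
Hypothesis bv : bm v.
Hypothesis v0 : forall x, 0 <= v x.
Hypothesis l0 : 0 < l.

Let exceeds i x := l * #|` F i|%:R < \sum_(g <- F i) v (act g x).
Definition exceptional N : set X := [set x | exists2 i, (i < N)%N & exceeds i x].

Lemma measurable_exceptional N : measurable (exceptional N).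
Proof.
rewrite (_ : exceptional N = \bigcup_(i in [set i | (i < N)%N]) [set x | exceeds i x]).
  apply: bigcup_measurable => i _.
  have [m _] : bm (fun x => \sum_(g <- F i) v (act g x)).
    by apply: bm_sum => g; exact: (bm_act Hact).
  rewrite (_ : [set x | _] = (fun x => \sum_(g <- F i) v (act g x))
     @^-1` `]l * #|` F i|%:R, +oo[).
    by rewrite -[_ @^-1` _]setTI; exact: m.
  by apply/seteqP; split => x /=; rewrite in_itv /= andbT.
by apply/seteqP; split => [x [i]|x [i]] ? ?; exists i.
Qed.

Let reach N (K : {fset G}) :=
  [fset gmul L g k | g in \big[fsetU/fset0]_(i < N) F i, k in K]%fset.

(** The cover is applied to the times [k] in [K] at which the orbit of [x] is exceptional, each with
    a level witnessing this. On every translate the sum of [v] exceeds [l] times the cardinality,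
    and since loads are at most 1 the weighted total is at most the sum of [v] over [reach N K]. The
    part outside [K] costs at most [C] per point. *)
Lemma orbit_exceptional_bound (N : nat) (K : {fset G}) (C : R) x :
  (forall x, v x <= C) ->
  l * \sum_(k <- K) \1_(exceptional N) (act k x) <=
    (1 + c) * (\sum_(k <- K) v (act k x) + C * #|` reach N K `\` K|%fset%:R).
Proof.
move=> vC; set T := reach N K.
have /choice[lev levP] : forall k, exists i, exceptional N (act k x) ->
    (i < N)%N /\ exceeds i (act k x).
  move=> k; have [[i iN ik]|no] := pselect (exceptional N (act k x)); first by exists i.
  by exists 0%N.
pose A := [fset k in K | act k x \in exceptional N]%fset.
have AP a : a \in A -> (lev a < N)%N /\ exceeds (lev a) (act a x).
  by rewrite !inE /= => /andP[_ /set_mem]; exact: levP.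
have [p [p0 load cover]] := fractional_cover FF.1 Fc c0 (fun a aA => (AP a aA).1).
rewrite (_ : \sum_(k <- K) _ = #|` A|%:R); last first.
  by rewrite card_filter_fset; apply: eq_bigr => k _; rewrite indicE.
apply: (le_trans (ler_wpM2l (ltW l0) cover)); rewrite mulrCA ler_wpM2l ?addr_ge0//.
apply: (@le_trans _ _ (\sum_(a <- A) p a *
    \sum_(z <- T | z ** inv a \in F (lev a)) v (act z x))).
  rewrite mulr_sumr !big_seq; apply: ler_sum => a aA.
  rewrite mulrCA ler_wpM2l//.
  have [levN /ltW h] := AP a aA; apply: (le_trans h).
  rewrite (big_fset_condE _ T (fun z => z ** inv a \in F (lev a))).
  rewrite (eq_bigr (fun g => v (act (g ** a) x))); last first.
    by move=> g _; rewrite (actM Hact).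
  have inj : {in F (lev a) &, injective (fun g => g ** a)}.
    by move=> g g' _ _; exact: gmul_injr.
  rewrite -(big_imfset _ imfset_key (fun z => v (act z x)) inj).
  rewrite le_eqVlt; apply/orP; left; apply/eqP; apply: eq_fbigl => z.
  apply/imfsetP/idP => [[g /= gF ->]|].
    rewrite !inE /= gmulgK gF andbT; apply/imfset2P; exists g => /=.
      by apply/bigfcupP; exists (Ordinal levN); rewrite ?mem_index_enum.
    by exists a => //=; move: aA; rewrite !inE /= => /andP[].
  rewrite !inE /= => /andP[_ zF]; exists (z ** inv a) => //.
  by rewrite gmulgKV.
rewrite (eq_bigr (fun a => \sum_(z <- T | z ** inv a \in F (lev a)) p a * v (act z x)));
  last by move=> a _; rewrite mulr_sumr.
rewrite (exchange_big_dep xpredT) //=.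
apply: (@le_trans _ _ (\sum_(z <- T) v (act z x))).
  apply: ler_sum => z _; rewrite -mulr_suml ler_piMl//; exact: load.
rewrite (sum_fset_ID T K) lerD//.
  rewrite (sum_fset_ID K T) fsetIC lerDl sumr_ge0//.
by rewrite -sum_cst_fset; apply: ler_sum.
Qed.

(** The orbit bound is integrated with [K] a late Folner set. Invariance turns both orbit sums into
    multiples of [|F n|], and the boundary term is at most [e |F n|] with [e] arbitrary. *)
Lemma maximal_inequality_finite N : l * pr mu (exceptional N) <= (1 + c) * mean v.
Proof.
have [C C0 vC] := bm_ge0 bv.
have vC' x : v x <= C by apply: le_trans (vC x); exact: ler_norm.
have mE := measurable_exceptional N.
apply/ler_addgt0Pr => e e0.
have c1 : 0 < 1 + c by rewrite ltr_pwDl.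
have [n /(_ _ (leqnn _)) Hn] := folner_mul_setD (\big[fsetU/fset0]_(i < N) F i) FF
  (divr_gt0 e0 (mulr_gt0 c1 C0)).
rewrite -/(reach N (F n)) in Hn.
have cF := folner_gt0 n FF.
rewrite -(ler_pM2l cF).
have b1 g : bm (fun x => \1_(exceptional N) (act g x)).
  exact: (bm_act Hact g (bm_indic mE)).
have bvg g : bm (fun x => v (act g x)) by exact: (bm_act Hact g bv).
have := le_mean mu _ _ (fun x => orbit_exceptional_bound N (F n) x vC').
rewrite meanZ; last exact: bm_sum.
rewrite meanZ; last by apply: bmD; [exact: bm_sum|exact: bm_cst].
rewrite meanD; [|exact: bm_sum|exact: bm_cst].
rewrite mean_cst !mean_sum//.
under eq_bigr => g _ do rewrite (mean_act Hact g (bm_indic mE)) mean_indic//.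
under [X in _ * (X + _)]eq_bigr => g _ do rewrite (mean_act Hact g bv).
rewrite !sum_cst_fset => h.
rewrite mulrCA [#|`F n|%:R * pr _ _]mulrC; apply: (le_trans (h _ _)).
- by apply: bmM; [exact: bm_cst|exact: bm_sum].
- apply: bmM; first exact: bm_cst.
  by apply: bmD; [exact: bm_sum|exact: bm_cst].
have cC : 0 < (1 + c) * C by rewrite mulr_gt0.
rewrite mulrDr [leRHS](_ : _ = (1 + c) * (mean v * #|` F n|%:R) + e * #|` F n|%:R);
  last by ring.
rewrite lerD2l mulrA; apply: (le_trans (ler_wpM2l (ltW cC) Hn)).
by rewrite mulrA mulrCA divff ?mulr1// gt_eqF.
Qed.

Lemma tempered_maximal_inequality : exists E : set X,
  [/\ measurable E, l * pr mu E <= (1 + c) * mean v &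
   forall x n, ~ E x -> \sum_(g <- F n) v (act g x) <= l * #|` F n|%:R].
Proof.
exists (\bigcup_N exceptional N); split.
- by apply: bigcup_measurable => N _; exact: measurable_exceptional.
- have cv : (mu \o exceptional) @ \oo --> mu (\bigcup_N exceptional N).
    apply: nondecreasing_cvg_mu => [N||a b ab].
    + exact: measurable_exceptional.
    + by apply: bigcup_measurable => N _; exact: measurable_exceptional.
    apply/subsetPset => x [i ia ix]; exists i => //; exact: leq_trans ab.
  rewrite mulrC -ler_pdivlMr// -lee_fin -mu_pr; last first.
    by apply: bigcup_measurable => N _; exact: measurable_exceptional.
  rewrite -(cvg_lim _ cv)//; apply: lime_le; first by apply/cvg_ex; eexists; exact: cv.
  apply: nearW => N /=; rewrite mu_pr; last exact: measurable_exceptional.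
  by rewrite lee_fin ler_pdivlMr// mulrC maximal_inequality_finite.
- move=> x n nE; rewrite leNgt; apply/negP => h; apply: nE.
  by exists n.+1 => //; exists n.
Qed.

End MaximalInequality.

(** * Equicontinuous approximation *)

Section RealLimSup.
Variable R : realType.
Implicit Types (u v : nat -> R).

(** Because of [fine], this is the upper limit only when the latter is finite, in particular for
    bounded sequences. *)
Definition real_limsup u : R := fine (limn_esup (fun n => (u n)%:E)).
Local Notation ls := real_limsup.

Lemma real_limsupE u (C : R) : (forall n, `|u n| <= C) ->
  limn_esup (fun n => (u n)%:E) = (ls u)%:E.
Proof.
move=> uC; rewrite /ls fineK// fin_numE; apply/andP; split.
  rewrite gt_eqF//; apply: (@lt_le_trans _ _ (- C)%:E); first exact: ltNyr.
  apply: limn_esup_ge => N; exists N => //.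
  by rewrite lee_fin; have := uC N; rewrite ler_norml => /andP[].
rewrite lt_eqF//; apply: (@le_lt_trans _ _ C%:E); last exact: ltry.
apply: (@limn_esup_le _ _ _ 0%N) => n _.
by rewrite lee_fin; have := uC n; rewrite ler_norml => /andP[].
Qed.

Lemma real_limsup_norm u (C : R) : (forall n, `|u n| <= C) -> `|ls u| <= C.
Proof.
move=> uC; rewrite ler_norml -!lee_fin -(real_limsupE uC); apply/andP; split.
  apply: limn_esup_ge => N; exists N => //.
  by rewrite lee_fin; have := uC N; rewrite ler_norml => /andP[].
apply: (@limn_esup_le _ _ _ 0%N) => n _.
by rewrite lee_fin; have := uC n; rewrite ler_norml => /andP[].
Qed.

Lemma real_limsup_sub_le u v (C a : R) :
  (forall n, `|u n| <= C) -> (forall n, `|v n| <= C) ->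
  (forall e, 0 < e -> exists N, forall n, (N <= n)%N -> `|u n - v n| <= a + e) ->
  ls u - ls v <= a.
Proof.
move=> uC vC H; apply/ler_addgt0Pr => e e0.
have e2 : 0 < e / 2 by rewrite divr_gt0.
have [N HN] := H _ e2.
have [M HM] : exists M, forall n, (M <= n)%N -> ((v n)%:E < (ls v + e / 2)%:E)%E.
  by apply: limn_esup_lt; rewrite (real_limsupE vC) lte_fin ltrDl.
rewrite lerBlDr -lee_fin -(real_limsupE uC).
apply: (@limn_esup_le _ _ _ (maxn N M)) => n; rewrite geq_max => /andP[/HN nN /HM nM].
rewrite lte_fin in nM; rewrite lee_fin.
by move: nN; rewrite ler_norml => /andP[_]; lra.
Qed.

Lemma real_limsup_dist u v (C a : R) :
  (forall n, `|u n| <= C) -> (forall n, `|v n| <= C) ->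
  (forall e, 0 < e -> exists N, forall n, (N <= n)%N -> `|u n - v n| <= a + e) ->
  `|ls u - ls v| <= a.
Proof.
move=> uC vC H; apply/ler_normlP; split; last exact: real_limsup_sub_le uC vC H.
rewrite opprB; apply: (real_limsup_sub_le vC uC) => e /H[N HN].
by exists N => n /HN; rewrite distrC.
Qed.

Lemma real_limsup_cst (c : R) : ls (fun=> c) = c.
Proof.
apply: EFin_inj; rewrite -(@real_limsupE _ `|c|)//; apply/eqP; rewrite eq_le.
apply/andP; split; first exact: (@limn_esup_le _ _ _ 0%N).
by apply: limn_esup_ge => N; exists N.
Qed.

End RealLimSup.

Section FastSubsequence.
Variable R : realType.

Lemma unbounded_fiber (T : finType) (c : nat -> T) (I : set nat) :
  (forall N, exists2 n, (N <= n)%N & I n) ->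
  exists t, forall N, exists2 n, (N <= n)%N & I n /\ c n = t.
Proof.
move=> UI; apply: contrapT => no.
have /choice[b bP] : forall t, exists N, forall n, (N <= n)%N -> ~ (I n /\ c n = t).
  move=> t; apply: contrapT => nt; apply: no; exists t => N.
  by apply: contrapT => nN; apply: nt; exists N => n Nn H; apply: nN; exists n.
have [n nb In] := UI (\max_t b t).
by apply: (bP (c n) n) => //; apply: leq_trans nb; exact: leq_bigmax.
Qed.

(** Pigeonhole on colours gives a decreasing sequence of unbounded index sets, the [j]-th of
    [D]-diameter at most [e j]. Both [u j] and [u j.+1] belong to the [j]-th one. *)
Lemma fast_subsequence (D : nat -> nat -> R) (N0 : nat) (e : nat -> R) :
  (forall j, 0 < e j) ->
  (forall a, 0 < a -> exists (T : finType) (c : nat -> T),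
     forall n m, (N0 <= n)%N -> (N0 <= m)%N -> c n = c m -> D n m <= a) ->
  exists u : nat -> nat, (forall j, (N0 <= u j)%N) /\ (forall j, (j <= u j)%N) /\
    (forall j, D (u j) (u j.+1) <= e j).
Proof.
move=> e0 H; pose unb (I : set nat) := forall N, exists2 n, (N <= n)%N & I n.
pose good (I : set nat) a := forall n m, I n -> I m -> D n m <= a.
(* The state holds the current index set, the last chosen index and the step number. A bounded index
   set never arises; allowing it only makes the step total. *)
have step (s : set nat * nat * nat) : exists s' : set nat * nat * nat,
    s'.2 = s.2.+1 /\ (unb s.1.1 -> [/\ unb s'.1.1, s'.1.1 `<=` s.1.1,
      s'.1.1 s'.1.2, (s.1.2 < s'.1.2)%N & (N0 <= s'.1.2)%N /\ good s'.1.1 (e s.2)]).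
  case: s => [[I n] j] /=; have [UI|nUI] := pselect (unb I); last first.
    by exists (I, n, j.+1); split.
  have [T [c cP]] := H _ (e0 j); have [t tP] := unbounded_fiber c UI.
  have [n' nn' [In' cn']] := tP (maxn N0 n.+1).
  exists ([set m | [/\ I m, (N0 <= m)%N & c m = t]], n', j.+1); split => // _; split => /=.
  - move=> N; have [m] := tP (maxn N0 N); rewrite geq_max => /andP[mN0 mN] [Im cm].
    by exists m.
  - by move=> m [].
  - by split => //; exact: leq_trans (leq_maxl _ _) nn'.
  - exact: leq_trans (leq_maxr _ _) nn'.
  - split; first exact: leq_trans (leq_maxl _ _) nn'.
    by move=> a b [_ aN ca] [_ bN cb]; apply: cP => //; rewrite ca cb.
have [s [s0 sP]] := dependent_choice (fun s => cid (step s)) ([set: nat], 0%N, 0%N).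
have s2 j : (s j).2 = j.
  by elim: j => [|j IH]; [rewrite s0|have [-> _] := sP j; rewrite IH].
have sU j : unb (s j).1.1.
  elim: j => [|j IH]; first by rewrite s0 => N; exists N.
  by have [_ /(_ IH)[]] := sP j.
have sPj j := (sP j).2 (sU j).
(* Shifted by one, since the initial state carries no diameter bound. *)
exists (fun j => (s j.+1).1.2); split=> [j|]; first by have [_ _ _ _ []] := sPj j.
split=> [j|j].
  elim: j => [|j IH] //; have [_ _ _ h _] := sPj j.+1; exact: leq_ltn_trans IH h.
have [_ _ Ij _ [_ g]] := sPj j; have [_ sub Ij' _ _] := sPj j.+1.
by have := g _ _ Ij (sub _ Ij'); rewrite s2.
Qed.

End FastSubsequence.

Section FastSums.
Context {d : measure_display} {X : measurableType d} {R : realType}.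
Variable mu : probability X R.
Local Notation bm := (@bounded_measurable d X R).
Local Notation mean := (mean mu).

Lemma geometric_half_sum_le (r : R) n : 0 <= r ->
  \sum_(0 <= j < n) r / 2 ^+ j.+1 <= r.
Proof.
move=> r0; suff -> : \sum_(0 <= j < n) r / 2 ^+ j.+1 = r - r / 2 ^+ n.
  by rewrite gerBl divr_ge0// exprn_ge0.
elim: n => [|n IH]; first by rewrite big_nil expr0 divr1 subrr.
rewrite big_nat_recr //= IH exprS.
have : (2 : R) ^+ n != 0 by rewrite expf_neq0// pnatr_eq0.
by move: (2 ^+ n) => a a0; field.
Qed.

Lemma bm_real_limsup (psi : nat -> X -> R) (C : R) :
  (forall n, bm (psi n)) -> (forall n x, `|psi n x| <= C) ->
  bm (fun x => real_limsup (fun n => psi n x)).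
Proof.
move=> bpsi pC; split; last by exists C => x; exact: real_limsup_norm.
apply: (@measurableT_comp _ _ _ _ _ _ (@fine R)).
  exact: fine_measurable.
apply: measurable_fun_limn_esup => n; apply/measurable_EFinP.
by case: (bpsi n).
Qed.

(** Telescoping bounds the integrand pointwise by the series of the [D j], trivially where the
    series diverges. Termwise integration leaves a geometric series of sum at most [r]. *)
Lemma fast_limsup (psi : nat -> X -> R) (C r : R) : 0 <= r ->
  (forall n, bm (psi n)) -> (forall n x, `|psi n x| <= C) ->
  (forall j, mean (fun x => `|psi j x - psi j.+1 x|) <= r / 2 ^+ j.+1) ->
  mean (fun x => `|real_limsup (fun n => psi n x) - psi 0%N x|) <= r.
Proof.
move=> r0 bpsi pC pfast; set phi := fun x => real_limsup (fun n => psi n x).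
have bphi : bm phi by exact: bm_real_limsup pC.
pose D j x := `|psi j x - psi j.+1 x|.
have bD j : bm (D j) by apply/bm_norm/bmB.
have bd : bm (fun x => `|phi x - psi 0%N x|) by apply/bm_norm/bmB.
rewrite -lee_fin EFin_mean//.
have mD j : measurable_fun setT (fun x => (D j x)%:E).
  by apply/measurable_EFinP; case: (bD j).
have D0 j x : (0 <= (D j x)%:E)%E by rewrite lee_fin normr_ge0.
apply: (@le_trans _ _ (\int[mu]_x \sum_(0 <= j <oo) (D j x)%:E)%E).
  apply: ge0_le_integral => //.
  - by apply/measurable_EFinP; case: bd.
  - exact: ge0_emeasurable_sum.
  move=> x _.
  have [->|Sfin] := eqVneq (\sum_(0 <= j <oo) (D j x)%:E)%E +oo%E; first exact: leey.
  have S0 : (0 <= \sum_(0 <= j <oo) (D j x)%:E)%E by exact: nneseries_ge0.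
  have Sf : (\sum_(0 <= j <oo) (D j x)%:E)%E \is a fin_num.
    by rewrite ge0_fin_numE// ltey.
  rewrite -(fineK Sf) lee_fin -(real_limsup_cst (psi 0%N x)).
  apply: (@real_limsup_dist _ _ _ C) => // e e0; exists 0%N => n _.
  apply: ler_wpDr; first exact: ltW.
  rewrite -lee_fin (fineK Sf).
  apply: (le_trans _ (@nneseries_lim_ge _ _ xpredT 0%N n _)) => //.
  rewrite sumEFin lee_fin -(telescope_sumr (fun j => psi j x))//.
  apply: (le_trans (ler_norm_sum _ _ _)); apply: ler_sum => j _.
  by rewrite distrC.
rewrite integral_nneseries//; apply: lime_le; first
  by apply: is_cvg_nneseries => n _ _; exact: integral_ge0.
apply: nearW => n; under eq_bigr do rewrite -EFin_mean//.
rewrite sumEFin lee_fin; apply: le_trans (geometric_half_sum_le n r0).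
by apply: ler_sum => j _; exact: pfast.
Qed.

(** The label is the integer part of the nonnegative function [(phi + C) / e]. *)
Lemma finite_quantization (phi : X -> R) (e : R) : bm phi -> 0 < e ->
  exists (T : finType) (q : X -> T), measurable_fibers q /\
    forall x y, q x = q y -> `|phi x - phi y| <= e.
Proof.
move=> bphi e0; have [C C0 pC] := bm_ge0 bphi.
pose z x := (phi x + C) / e.
have z0 x : 0 <= z x.
  rewrite divr_ge0 ?(ltW e0)// -lerBlDr sub0r.
  by have := pC x; rewrite ler_norml => /andP[].
pose M := Num.truncn (2 * C / e).
have zM x : (Num.truncn (z x) < M.+1)%N.
  rewrite ltnS; apply: le_truncn; rewrite ler_wpM2r ?invr_ge0 ?(ltW e0)//.
  by rewrite mulr_natl mulr2n lerD2r; apply: le_trans (pC x); exact: ler_norm.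
have zb x : (Num.truncn (z x))%:R <= z x < (Num.truncn (z x)).+1%:R by exact: truncn_itv.
exists 'I_M.+1, (fun x => Ordinal (zM x)); split.
  move=> i; rewrite (_ : _ @^-1` _ = z @^-1` `[(i : nat)%:R, i.+1%:R[).
    have [m _] : bm z by apply: bmM; [apply: bmD => //|]; exact: bm_cst.
    by rewrite -[_ @^-1` _]setTI; exact: m.
  apply/seteqP; split => x /=; rewrite in_itv /=.
    by move=> <- /=; exact: zb.
  move=> iz; apply/val_inj => /=; apply/eqP.
  have := zb x; move: iz => /andP[a b] /andP[a' b'].
  rewrite eqn_leq -ltnS -(ltr_nat R) (le_lt_trans a' b) /=.
  by rewrite -ltnS -(ltr_nat R) (le_lt_trans a b').
move=> x y /(congr1 val) /= xy.
have := zb x; have := zb y; rewrite -xy -natr1 => /andP[a b] /andP[a' b'].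
have h : `|z x - z y| <= 1 by rewrite ler_norml; lra.
rewrite (_ : phi x - phi y = e * (z x - z y)); last by rewrite /z; field; rewrite gt_eqF.
by rewrite normrM gtr0_norm// ler_piMr// ltW.
Qed.

End FastSums.

(** * Weighted averages along a Folner sequence *)

Section Smoothing.
Context {d : measure_display} {X : measurableType d} {R : realType}.
Variables (mu : probability X R) (G : choiceType) (L : group_law G).
Variable act : G -> X -> X.
Hypothesis Hact : mp_action mu L act.
Local Notation bm := (@bounded_measurable d X R).
Local Notation mean := (mean mu).
Local Notation "a ** b" := (gmul L a b) (at level 40, left associativity).
Local Notation inv := (ginv L).
Local Notation one := (gone L).
Local Notation boundary := (boundary R L).

Variables (F : nat -> {fset G}) (f : X -> R) (C r : R).
Hypothesis FF : @folner G L F R.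
Hypothesis bf : bm f.
Hypothesis C0 : 0 < C.
Hypothesis fC : forall x, `|f x| <= C.
Hypothesis cf : finitely_colourable (orbit_dist mu act f).
Hypothesis r0 : 0 < r.
Local Notation rho := (orbit_dist mu act f).

(** A bump around the identity, 1-Lipschitz for [rho] and zero beyond distance [r]. Its small
    support keeps the averages near [f]; its Lipschitz property makes them equicontinuous along
    orbits. *)
Let w g := Num.max 0 (r - rho g one).
Let S n := \sum_(g <- F n) w g.
Let phi n x := (\sum_(g <- F n) w g * f (act (inv g) x)) / S n.

Let w_ge0 g : 0 <= w g. Proof. by rewrite /w le_max lexx. Qed.

Let w_le g : w g <= r.
Proof. by rewrite /w ge_max ltW//= gerBl orbit_dist_ge0. Qed.

Let w_dist g h k : `|w (g ** k) - w (h ** k)| <= rho g h.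
Proof.
have t1 := orbit_dist_triangle Hact bf (g ** k) (h ** k) one.
have t2 := orbit_dist_triangle Hact bf (h ** k) (g ** k) one.
rewrite (orbit_distMr Hact bf) in t1.
rewrite (orbit_distMr Hact bf) (orbit_distC _ _ _ h g) in t2.
have p := orbit_dist_ge0 mu act f g h.
rewrite /w; have [a|a] := leP 0 (r - rho (g ** k) one);
  have [b|b] := leP 0 (r - rho (h ** k) one); rewrite ler_norml; lra.
Qed.

Let w_rho g : w g * rho g one <= w g * r.
Proof.
rewrite /w; have [a|a] := leP 0 (r - rho g one); last by rewrite !mul0r.
by rewrite ler_wpM2l// -subr_ge0.
Qed.

(* Finitely many translates of the support of [w] cover the group, so the
   support has positive lower density. *)
Lemma weight_density : exists c : R, 0 < c /\ exists N, forall n, (N <= n)%N ->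
  c * #|` F n|%:R <= S n.
Proof.
have r2 : 0 < r / 2 by rewrite divr_gt0.
have [m [s sP]] := colourable_net cf r2.
have m1 : 0 < m%:R + 1 :> R by rewrite ltr_wpDl.
(* With this tolerance the errors of the [m] translations add up to less than half of [|F n|]. *)
have e0 : 0 < (2 * (m%:R + 1))^-1 :> R by rewrite invr_gt0 mulr_gt0.
have [N HN] := folner_small FF [seq s i | i <- enum 'I_m] e0.
exists (r / 2 * (2 * (m%:R + 1))^-1); split; first by rewrite mulr_gt0.
exists N => n /HN Hn; have cF := folner_gt0 n FF.
pose u g : R := (rho g one <= r / 2)%R%:R.
have u1 g : `|u g| <= 1 by rewrite /u normr_nat lern1 leq_b1.
have uw g : r / 2 * u g <= w g.
  rewrite /u; have [h|_] := boolP (rho g one <= r / 2); last by rewrite mulr0.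
  by rewrite mulr1 /w le_max; apply/orP; right; lra.
(* If [s i] is close to [g^-1], then [s i ** g] is close to the identity by right invariance. *)
have cover g : 1 <= \sum_(i < m) u (s i ** g).
  have [i gi] := sP (inv g); rewrite (bigD1 i) //=.
  rewrite /u (_ : rho (s i ** g) one <= r / 2); last first.
    by rewrite -(gmulVg L g) (orbit_distMr Hact bf) orbit_distC.
  by rewrite lerDl sumr_ge0.
have : #|` F n|%:R <= m%:R * (\sum_(g <- F n) u g + (2 * (m%:R + 1))^-1 * #|` F n|%:R).
  rewrite {1}card_sum_fset.
  apply: (@le_trans _ _ (\sum_(g <- F n) \sum_(i < m) u (s i ** g))).
    by apply: ler_sum => g _; exact: cover.
  rewrite exchange_big /= [leRHS](_ : _ = \sum_(i < m)
     (\sum_(g <- F n) u g + (2 * (m%:R + 1))^-1 * #|` F n|%:R)); last first.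
    by rewrite sumr_const card_ord mulr_natl.
  apply: ler_sum => i _; rewrite -lerBlDl.
  have := sum_translate L (s i) (F n) u1; rewrite mul1r => h.
  apply: le_trans (ler_norm _) (le_trans h (Hn _ _)).
  by apply/mapP; exists i; rewrite ?mem_enum.
have Sge : r / 2 * \sum_(g <- F n) u g <= S n.
  by rewrite mulr_sumr; apply: ler_sum.
move=> h; apply: le_trans Sge; rewrite -mulrA ler_pM2l//.
set q := \sum_(g <- F n) u g in h *.
have q0 : 0 <= q by apply: sumr_ge0.
move: h cF m1; move: (#|` F n|%:R : R) (m%:R : R) (ler0n R m) => a b b0 h a0 b1.
have ab : b * ((2 * (b + 1))^-1 * a) <= a / 2.
  rewrite (_ : _ * _ = (b / (b + 1)) * (a / 2)); last by field; rewrite gt_eqF.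
  by rewrite ler_piMl ?divr_ge0 ?(ltW a0)// ler_pdivrMr// mul1r lerDl.
rewrite (_ : (2 * (b + 1))^-1 * a = (a / 2) / (b + 1)); last by field; rewrite gt_eqF.
rewrite ler_pdivrMr//; rewrite mulrDr in h.
rewrite mulrDr mulr1 [q * b]mulrC; lra.
Qed.

Section Bounds.
Variables (c : R) (N : nat).
Hypothesis c0 : 0 < c.
Hypothesis Sc : forall n, (N <= n)%N -> c * #|` F n|%:R <= S n.

Let S_gt0 n : (N <= n)%N -> 0 < S n.
Proof. by move=> /Sc; apply: lt_le_trans; rewrite mulr_gt0// (folner_gt0 n FF). Qed.

Let bm_shift g : bm (fun x => f (act g x)). Proof. exact: (bm_act Hact g bf). Qed.

Lemma bm_weighted_average n : bm (phi n).
Proof.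
apply: bmM; last exact: bm_cst.
by apply: bm_sum => g; apply: bmM => //; exact: bm_cst.
Qed.

Lemma weighted_average_norm n x : (N <= n)%N -> `|phi n x| <= C.
Proof.
move=> /S_gt0 Sn; rewrite /phi normrM normfV (gtr0_norm Sn) ler_pdivrMr//.
rewrite /S mulr_sumr (le_trans (ler_norm_sum _ _ _))//; apply: ler_sum => g _.
by rewrite normrM ger0_norm// mulrC ler_wpM2r.
Qed.

(** Only [g] within [r] of the identity carry weight, and [g^-1] is as far from the identity as [g]
    by right invariance. *)
Lemma weighted_average_close n : (N <= n)%N -> mean (fun x => `|phi n x - f x|) <= r.
Proof.
move=> /S_gt0 Sn.
have bD g : bm (fun x => `|f (act g x) - f (act one x)|) by exact: (bm_orbit_diff Hact bf).
have bwD g : bm (fun x => w g * `|f (act (inv g) x) - f (act one x)|).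
  by apply: bmM => //; exact: bm_cst.
apply: (@le_trans _ _ (mean (fun x => (S n)^-1 *
   \sum_(g <- F n) w g * `|f (act (inv g) x) - f (act one x)|))).
  apply: le_mean; first by apply/bm_norm/bmB => //; exact: bm_weighted_average.
    by apply: bmM; [exact: bm_cst|exact: bm_sum].
  move=> x; rewrite mulrC ler_pdivlMr// -{1}(gtr0_norm Sn) -normrM.
  rewrite mulrBl /phi mulfVK ?gt_eqF// mulrC /S mulr_suml -sumrB.
  apply: (le_trans (ler_norm_sum _ _ _)); apply: ler_sum => g _.
  by rewrite -mulrBr normrM (act1 Hact) ger0_norm.
rewrite meanZ; last exact: bm_sum.
rewrite mean_sum// mulrC ler_pdivrMr// /S mulr_sumr; apply: ler_sum => g _.
rewrite meanZ// -/(rho (inv g) one) mulrC [leRHS]mulrC.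
by rewrite -(orbit_distMr Hact bf _ _ g) gmulVg gmul1g orbit_distC mulrC w_rho.
Qed.

(** Substituting [a^-1 k] for [k] moves [a] from the point to the weight: up to a boundary term,
    [phi n (a x)] is the average of [w (a k) f (k^-1 x)]. The weights for [g] and [h] differ by at
    most [rho g h], uniformly in [x]. *)
Lemma weighted_average_orbit n g h x : (N <= n)%N ->
  `|phi n (act g x) - phi n (act h x)| <=
    C / c * rho g h + r * C / c *
      ((boundary (inv g) (F n) + boundary (inv h) (F n)) / #|` F n|%:R).
Proof.
move=> Nn; have Sn := S_gt0 Nn; have cF := folner_gt0 n FF.
pose v a k := w (a ** k) * f (act (inv k) x).
have vC a k : `|v a k| <= r * C.
  by rewrite /v normrM ler_pM// ger0_norm.
have shift a : phi n (act a x) = (\sum_(k <- F n) v a (inv a ** k)) / S n.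
  rewrite /phi; congr (_ / _); apply: eq_bigr => k _.
  rewrite /v gmulVK -(actM Hact); congr (_ * f (act _ x)).
  apply: (@gmul_injl _ L (inv a ** k)); rewrite gmulgV.
  by rewrite -gmulA gmulVK gmulVg.
have main : `|\sum_(k <- F n) v g (inv g ** k) - \sum_(k <- F n) v h (inv h ** k)|
   <= #|` F n|%:R * (C * rho g h) + r * C * (boundary (inv g) (F n) + boundary (inv h) (F n)).
  have t1 := sum_translate L (inv g) (F n) (vC g).
  have t2 := sum_translate L (inv h) (F n) (vC h).
  have t3 : `|\sum_(k <- F n) v g k - \sum_(k <- F n) v h k| <= #|` F n|%:R * (C * rho g h).
    rewrite -sumrB mulrC; apply: sum_bounded_fset => k.
    by rewrite /v -mulrBl normrM mulrC ler_pM.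
  move: t1 t2 t3; rewrite mulrDr !ler_norml => /andP[? ?] /andP[? ?] /andP[? ?]; lra.
rewrite !shift -mulrBl normrM normfV (gtr0_norm Sn) ler_pdivrMr//.
apply: (le_trans main).
set b := boundary _ _ + _; set p := rho g h.
have b0 : 0 <= b by rewrite addr_ge0// ler0n.
have p0 : 0 <= p by exact: orbit_dist_ge0.
have -> : #|` F n|%:R * (C * p) + r * C * b =
  (C / c * p + r * C / c * (b / #|` F n|%:R)) * (c * #|` F n|%:R).
  by field; rewrite !gt_eqF.
rewrite ler_wpM2l ?Sc// addr_ge0// mulr_ge0// ?divr_ge0 ?(ltW C0) ?(ltW c0)//.
by rewrite mulr_ge0 ?(ltW C0) ?(ltW r0).
Qed.


(** Replacing each translate of [f] by that of a representative of its colour changes the average by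
    at most [e / 4]. The result [psi] combines finitely many fixed functions with coefficients in
    [0, 1], and the colour records these coefficients up to [1 / M]. *)
Lemma weighted_average_precompact (e : R) : 0 < e ->
  exists (T : finType) (col : nat -> T), forall n m, (N <= n)%N -> (N <= m)%N ->
    col n = col m -> mean (fun x => `|phi n x - phi m x|) <= e.
Proof.
move=> e0; have e4 : 0 < e / 4 by rewrite divr_gt0.
have [T [cg cgP]] := cf e4.
have /choice[s sP] : forall t : T, exists g, (exists h, cg h = t) -> cg g = t.
  move=> t; have [[h ht]|no] := pselect (exists h, cg h = t); first by exists h.
  by exists one.
have sD g : rho g (s (cg g)) <= e / 4 by apply: cgP; rewrite sP//; exists g.
pose p n t := (\sum_(g <- F n | cg (inv g) == t) w g) / S n.
pose psi n x := \sum_t p n t * f (act (s t) x).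
have psiE n x : psi n x = (\sum_(g <- F n) w g * f (act (s (cg (inv g))) x)) / S n.
  rewrite (partition_big (fun g => cg (inv g)) xpredT) //= mulr_suml.
  apply: eq_bigr => t _; rewrite /p mulrAC mulr_suml; congr (_ / _).
  by apply: eq_bigr => g /eqP ->.
have bpsi n : bm (psi n).
  by apply: bm_sum => t; apply: bmM => //; exact: bm_cst.
have close n : (N <= n)%N -> mean (fun x => `|phi n x - psi n x|) <= e / 4.
  move=> /S_gt0 Sn.
  have bwD g : bm (fun x => w g * `|f (act (inv g) x) - f (act (s (cg (inv g))) x)|).
    by apply: bmM; [exact: bm_cst|exact: (bm_orbit_diff Hact bf)].
  apply: (@le_trans _ _ (mean (fun x => (S n)^-1 *
     \sum_(g <- F n) w g * `|f (act (inv g) x) - f (act (s (cg (inv g))) x)|))).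
    apply: le_mean; first by apply/bm_norm/bmB => //; exact: bm_weighted_average.
      by apply: bmM; [exact: bm_cst|exact: bm_sum].
    move=> x; rewrite psiE /phi -mulrBl normrM normfV (gtr0_norm Sn) mulrC.
    rewrite ler_wpM2l ?invr_ge0 ?(ltW Sn)// -sumrB.
    apply: (le_trans (ler_norm_sum _ _ _)); apply: ler_sum => g _.
    by rewrite -mulrBr normrM ger0_norm.
  rewrite meanZ; last exact: bm_sum.
  rewrite mean_sum// mulrC ler_pdivrMr// /S mulr_sumr; apply: ler_sum => g _.
  rewrite meanZ; last exact: (bm_orbit_diff Hact bf).
  by rewrite mulrC ler_wpM2r// sD.
(* Large enough that [#|T|] coefficient errors of [1 / M], each multiplied by a value at most [C],
   cost at most [e / 2]. *)
pose M := (Num.truncn (#|T|%:R * C / (e / 2))).+1.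
have M0 : 0 < (M%:R : R) by rewrite ltr0n.
have TM : #|T|%:R * C / M%:R <= e / 2.
  rewrite ler_pdivrMr// [leRHS]mulrC -ler_pdivrMr ?divr_gt0//.
  exact/ltW/truncnS_gt.
have p0 n t : (N <= n)%N -> 0 <= p n t.
  by move=> /S_gt0 Sn; rewrite divr_ge0 ?(ltW Sn)// sumr_ge0.
have p1 n t : (N <= n)%N -> p n t <= 1.
  move=> /S_gt0 Sn; rewrite ler_pdivrMr// mul1r /S big_mkcond.
  by apply: ler_sum => g _; case: ifP.
have pM n t : (N <= n)%N -> (Num.truncn (p n t * M%:R) < M.+1)%N.
  move=> Nn; rewrite -(ltr_nat R); apply: (@le_lt_trans _ _ (p n t * M%:R)).
    by rewrite truncn_le mulr_ge0// p0.
  apply: (@le_lt_trans _ _ M%:R); last by rewrite ltr_nat.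
  by rewrite ler_piMl ?p1.
exists {ffun T -> 'I_M.+1}, (fun n => [ffun t => inord (Num.truncn (p n t * M%:R))]).
move=> n m Nn Nm /ffunP nm.
have pd t : `|p n t - p m t| <= M%:R^-1.
  have := congr1 val (nm t); rewrite !ffunE /= !inordK ?pM// => E.
  have /andP[a b] := truncn_itv (mulr_ge0 (p0 _ t Nn) (ler0n R M)).
  have /andP[a' b'] := truncn_itv (mulr_ge0 (p0 _ t Nm) (ler0n R M)).
  rewrite -[leRHS]mul1r ler_pdivlMr// -{1}(gtr0_norm M0) -normrM mulrBl ler_norml.
  by move: a b a' b'; rewrite E -natr1; lra.
apply: (@le_trans _ _ (mean (fun x => `|phi n x - psi n x| + (e / 2 +
   `|phi m x - psi m x|)))).
  have bphi := bm_weighted_average.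
  apply: le_mean; first by apply/bm_norm/bmB.
    apply: bmD; first by apply/bm_norm/bmB.
    by apply: bmD; [exact: bm_cst|apply/bm_norm/bmB].
  move=> x; have psid : `|psi n x - psi m x| <= e / 2.
    apply: le_trans TM; rewrite -sumrB (le_trans (ler_norm_sum _ _ _))//.
    rewrite -mulrA mulr_natl -[in leRHS]sumr_const.
    apply: ler_sum => t _; rewrite -mulrBl normrM mulrC.
    by apply: ler_pM.
  apply: (le_trans _ (lerD (lexx _) (lerD psid (lexx _)))).
  rewrite (distrC (phi m x)).
  apply: (le_trans _ (lerD (lexx _) (ler_normD _ _))).
  apply: (le_trans _ (ler_normD _ _)).
  by rewrite le_eqVlt; apply/orP; left; apply/eqP; congr (`| _ |); ring.
have bd k : bm (fun x => `|phi k x - psi k x|).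
  by apply/bm_norm/bmB => //; exact: bm_weighted_average.
rewrite !meanD ?mean_cst//; last by apply: bmD => //; exact: bm_cst.
  by move: (close n Nn) (close m Nm); lra.
exact: bm_cst.
Qed.

End Bounds.

(** The upper limit is defined at every point, so the orbit estimate passes to it without an
    exceptional set, the boundary terms tending to 0. One [r] pays for the first average and one for
    the fast convergence. *)
Lemma equicontinuous_approximation : exists (g : X -> R) (K : R),
  [/\ 0 < K, bm g, forall x a b, `|g (act a x) - g (act b x)| <= K * rho a b &
   mean (fun x => `|g x - f x|) <= 2 * r].
Proof.
have [c [c0 [N Sc]]] := weight_density.
pose D n m := mean (fun x => `|phi n x - phi m x|).
have e0 j : 0 < r / 2 ^+ j.+1 by rewrite divr_gt0// exprn_gt0.
have [u [Nu [uj uD]]] := fast_subsequence e0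
  (fun e e0 => weighted_average_precompact c0 Sc e0).
pose psi j x := phi (u j) x.
have bpsi j : bm (psi j) by exact: bm_weighted_average.
have psiC j x : `|psi j x| <= C by exact: (weighted_average_norm c0 Sc x (Nu j)).
exists (fun x => real_limsup (fun j => psi j x)), (C / c).
have cC : 0 < C / c by rewrite divr_gt0.
have bl := bm_real_limsup bpsi psiC.
split => //.
  move=> x a b; apply: (@real_limsup_dist _ _ _ C) => // e e1.
  have rCc : 0 < r * C / c by rewrite divr_gt0// mulr_gt0.
  have e2 : 0 < e / (2 * (r * C / c)) by rewrite divr_gt0// mulr_gt0.
  have [M HM] := folner_small FF [:: inv a; inv b] e2.
  exists M => j Mj; have := weighted_average_orbit c0 Sc a b x (Nu j).
  move=> h; apply: (le_trans h); rewrite lerD2l.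
  have Mu : (M <= u j)%N by exact: leq_trans Mj (uj j).
  have h1 := HM _ Mu (inv a); have h2 := HM _ Mu (inv b).
  rewrite inE eqxx in h1; rewrite !inE eqxx orbT in h2.
  have cF := folner_gt0 (u j) FF.
  rewrite mulrC -ler_pdivlMr// ler_pdivrMr//.
  apply: (le_trans (lerD (h1 isT) (h2 isT))).
  rewrite -mulrDl ler_pM2r// le_eqVlt; apply/orP; left; apply/eqP.
  by move: rCc; move: (r * C / c) => q q0; field; rewrite gt_eqF.
have b0 := weighted_average_close c0 Sc (Nu 0%N).
apply: (@le_trans _ _ (mean (fun x =>
   `|real_limsup (fun j => psi j x) - psi 0%N x| + `|psi 0%N x - f x|))).
  apply: le_mean; first by apply/bm_norm/bmB.
    by apply: bmD; apply/bm_norm/bmB.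
  by move=> x; apply: (le_trans _ (ler_normD _ _)); rewrite addrA subrK.
rewrite meanD; [|by apply/bm_norm/bmB|by apply/bm_norm/bmB].
rewrite mulr_natl mulr2n; apply: lerD => //.
exact: (fast_limsup (ltW r0) bpsi psiC uD).
Qed.

End Smoothing.

Section MeanEquicontinuity.
Context {d : measure_display} {X : measurableType d} {R : realType}.
Variables (mu : probability X R) (G : choiceType) (L : group_law G).
Variable act : G -> X -> X.
Hypothesis Hact : mp_action mu L act.
Local Notation bm := (@bounded_measurable d X R).
Local Notation mean := (mean mu).

(** Points are named by the quantized values of an equicontinuous approximation [g] along a net.
    Outside the exceptional set of the maximal inequality, [f] may be replaced by [g] at a cost of
    at most [l] per point on average, so equal names give [Hdist <= 2 * l + 3 * h < e]. *)
Lemma colourable_mean_equicont k (A : 'I_k -> set X) (t : X -> 'I_k)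
    (F : nat -> {fset G}) :
  is_partition A -> measurable_fibers t -> (forall i x, A i x <-> t x = i) ->
  finitely_colourable (orbit_dist mu act (fun x => (t x)%:R)) ->
  @folner G L F R -> @tempered G L F R -> mean_equicont mu act A F.
Proof.
move=> pA mt tE cf FF [c [c0 Fc]] e e0.
set f : X -> R := fun x => (t x)%:R.
have bf : bm f by exact: (@bm_fibers _ _ _ _ t (fun i : 'I_k => (i : nat)%:R)).
have [C C0 fC] := bm_ge0 bf.
pose l := e / 8.
have l0 : 0 < l by rewrite divr_gt0.
(* Then [(1 + c) * (2 * r) = l * e / 2], so the exceptional set has measure at most [e / 2]. *)
pose r := e * l / (4 * (1 + c)).
have c1 : 0 < 1 + c by rewrite addr_gt0.
have r0 : 0 < r by rewrite divr_gt0// mulr_gt0.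
have [g [K [K0 bg gK gf]]] := equicontinuous_approximation Hact FF bf C0 fC cf r0.
pose v (x : X) : R := `|g x - f x|.
have bv : bm v by apply/bm_norm/bmB.
have v0 x : 0 <= v x by exact: normr_ge0.
have [E [mE prE HE]] := tempered_maximal_inequality Hact FF (ltW c0) Fc bv v0 l0.
have prEe : pr mu E < e.
  rewrite -(ltr_pM2l l0); apply: (le_lt_trans prE).
  apply: (@le_lt_trans _ _ ((1 + c) * (2 * r))); first by rewrite ler_pM2l.
  rewrite (_ : _ * _ = l * e / 2); last by rewrite /r; field; rewrite gt_eqF.
  by rewrite ltr_pdivrMr// mulr_natr mulr2n ltrDl mulr_gt0.
pose h := e / 16.
have h0 : 0 < h by rewrite divr_gt0.
have [m [s sP]] := colourable_net cf (divr_gt0 h0 K0).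
have [T [q [mq qP]]] := finite_quantization bg h0.
pose name x : {ffun 'I_m -> T} := [ffun i => q (act (s i) x)].
have mname : measurable_fibers name.
  by apply: measurable_fibers_ffun => i; exact: (measurable_fibers_act Hact).
pose B (i : 'I_#|{ffun 'I_m -> T}|) := name @^-1` [set enum_val i] `&` ~` E.
have mEc := measurableC mE.
exists #|{ffun 'I_m -> T}|, B; split; [|split; [|split]].
- by move=> i; apply: measurableI => //; exact: mname.
- move=> i j ij; apply/seteqP; split => // x [[/= xi _] [/= xj _]].
  by move: ij; rewrite (enum_val_inj (etrans (esym xi) xj)) eqxx.
- rewrite (_ : \bigcup_(i in _) B i = ~` E); last first.
    apply/seteqP; split => [x [i _ []//]|x nE].
    by exists (enum_rank (name x)) => //; split => //=; rewrite enum_rankK.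
  by rewrite mu_pr// lte_fin prC// ltrD2l ltrN2.
move=> i x y [/= xi nEx] [/= yi nEy].
(* One [h] for passing from [b] to the net at [x], one for the equal names, one for returning at
   [y]. *)
have gxy b : `|g (act b x) - g (act b y)| <= 3 * h.
  have [j bj] := sP b.
  have near z : `|g (act b z) - g (act (s j) z)| <= h.
    apply: (le_trans (gK z b (s j))); rewrite mulrC -ler_pdivlMr//.
  have qxy : `|g (act (s j) x) - g (act (s j) y)| <= h.
    apply: qP; have /ffunP/(_ j) : name x = name y by rewrite xi yi.
    by rewrite !ffunE.
  move: (near x) (near y) qxy; rewrite !ler_norml.
  by move=> /andP[? ?] /andP[? ?] /andP[? ?]; lra.
apply: (@le_lt_trans _ _ (2 * l + 3 * h)%:E); last by rewrite lte_fin /l /h; lra.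
apply: (@limn_esup_le _ _ _ 0%N) => n _; rewrite lee_fin (Hdist_sum _ _ _ _ tE).
have cF := folner_gt0 n FF.
rewrite ler_pdivrMr//.
apply: (@le_trans _ _ (\sum_(b <- F n) (v (act b x) + (3 * h + v (act b y))))).
  apply: ler_sum => b _.
  apply: (le_trans (@neq_le_natr_dist R k (t (act b x)) (t (act b y)))).
  rewrite -/(f (act b x)) -/(f (act b y)) /v.
  apply: (le_trans _ (lerD (lexx _) (lerD (gxy b) (lexx _)))).
  rewrite (distrC _ (f (act b x))).
  apply: (le_trans _ (lerD (lexx _) (ler_normD _ _))).
  apply: (le_trans _ (ler_normD _ _)).
  by rewrite le_eqVlt; apply/orP; left; apply/eqP; congr (`| _ |); ring.
rewrite !big_split /= sum_cst_fset.
by have := HE x n nEx; have := HE y n nEy; lra.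
Qed.

End MeanEquicontinuity.

(** * Entropy *)

Section Logarithm.
Variable R : realType.

Lemma ln_le_sub1 (x : R) : 0 < x -> ln x <= x - 1.
Proof. by move=> x0; rewrite -[X in ln X](subrKC 1) le_ln1Dx// ltrBrDl subrr. Qed.

Lemma ln_prod (I : Type) (s : seq I) (F : I -> R) : (forall i, 0 < F i) ->
  ln (\prod_(i <- s) F i) = \sum_(i <- s) ln (F i).
Proof.
move=> F0; elim: s => [|i s IH]; first by rewrite !big_nil ln1.
by rewrite !big_cons lnM ?posrE ?prodr_gt0// IH.
Qed.

Lemma gibbs_term (p q : R) : 0 <= p -> 0 < q -> p * (ln q - ln p) <= q - p.
Proof.
rewrite le_eqVlt => /predU1P[<-|p0] q0; first by rewrite mul0r subr0 ltW.
rewrite -ln_div ?posrE//; apply: le_trans (ler_wpM2l (ltW p0) _) _.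
  exact: (ln_le_sub1 (divr_gt0 q0 p0)).
by rewrite mulrBr mulr1 mulrCA divff ?mulr1// gt_eqF.
Qed.

(** The right side is the entropy gained by splitting an atom of mass [a + b]. The bound
    [ln z <= z - 1] makes it at least [2 a b / (a + b)], which dominates the minimum. *)
Lemma entropy_split_ge_min (a b : R) : 0 <= a -> 0 <= b ->
  Num.min a b <= (a + b) * ln (a + b) - a * ln a - b * ln b.
Proof.
rewrite le_eqVlt => /predU1P[<-|a0] b0.
  by rewrite add0r mul0r subr0 subrr ge_min lexx.
move: b0; rewrite le_eqVlt => /predU1P[<-|b0].
  by rewrite addr0 mul0r subr0 subrr ge_min lexx orbT.
have s0 : 0 < a + b by rewrite addr_gt0.
have K u v : 0 < u -> u + v = a + b -> u * v / (a + b) <= u * (ln (a + b) - ln u).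
  move=> u0 uv; rewrite -mulrA ler_pM2l// -[leRHS]opprB -ln_div ?posrE// lerNr.
  apply: le_trans (ln_le_sub1 (divr_gt0 u0 s0)) _.
  rewrite le_eqVlt; apply/orP; left; apply/eqP.
  have -> : u = a + b - v by rewrite -uv addrK.
  by field; rewrite gt_eqF.
have h1 := K a b a0 erefl; have h2 := K b a b0 (addrC _ _).
apply: (@le_trans _ _ (a * b / (a + b) + b * a / (a + b))).
  rewrite -mulrDl ler_pdivlMr// mulrDr.
  have [ab|/ltW ba] := leP a b; [nra|nra].
by move: h1 h2; rewrite !mulrBr; lra.
Qed.

End Logarithm.

Section Entropy.
Context {d : measure_display} {X : measurableType d} {R : realType}.
Variable mu : probability X R.
Local Notation mfib := measurable_fibers.
Local Notation mean := (mean mu).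

Definition fiber_entropy (T : finType) (t : X -> T) : R :=
  entropy mu (fun i => t @^-1` [set i]).

Lemma fiber_entropy_mean (T : finType) (t : X -> T) : mfib t ->
  fiber_entropy t = mean (fun x => - ln (pr mu (t @^-1` [set t x]))).
Proof.
move=> mt; rewrite (mean_fibers mu (fun i => - ln (pr mu (t @^-1` [set i]))) mt).
by rewrite /fiber_entropy /entropy -sumrN; apply: eq_bigr => i _; rewrite mulrN.
Qed.

Lemma eq_fiber_entropy (T U : finType) (t : X -> T) (u : X -> U) :
  mfib t -> mfib u -> (forall x y, t x = t y <-> u x = u y) ->
  fiber_entropy t = fiber_entropy u.
Proof.
move=> mt mu' tu; rewrite !fiber_entropy_mean//; congr mean; apply/funext => x.
congr (- ln (pr mu _)); apply/seteqP; split => y /=; by move/tu.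
Qed.

Lemma sum_pr_fibers (T : finType) (t : X -> T) : mfib t ->
  \sum_i pr mu (t @^-1` [set i]) = 1.
Proof.
move=> mt; have := mean_fibers mu (fun=> 1) mt; rewrite mean_cst => ->.
by apply: eq_bigr => i _; rewrite mulr1.
Qed.

Lemma fiber_entropy_ge0 (T : finType) (t : X -> T) : mfib t -> 0 <= fiber_entropy t.
Proof.
move=> mt; rewrite /fiber_entropy /entropy oppr_ge0; apply: sumr_le0 => i _.
by rewrite mulr_ge0_le0// ?pr_ge0// ln_le0// pr_le1.
Qed.

Lemma gibbs (T : finType) (t : X -> T) (q : T -> R) : mfib t ->
  (forall i, 0 < q i) -> \sum_i q i <= 1 ->
  fiber_entropy t <= mean (fun x => - ln (q (t x))).
Proof.
move=> mt q0 q1; rewrite (mean_fibers mu (fun i => - ln (q i)) mt).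
rewrite /fiber_entropy /entropy -sumrN -subr_le0 -sumrB.
apply: (@le_trans _ _ (\sum_i (q i - pr mu (t @^-1` [set i])))).
  apply: ler_sum => i _; apply: le_trans (gibbs_term (pr_ge0 _ _) (q0 i)).
  by rewrite mulrN opprK mulrBr addrC.
by rewrite sumrB sum_pr_fibers// subr_le0.
Qed.

Lemma sum_pair (T U : finType) (F : T * U -> R) :
  \sum_p F p = \sum_i \sum_j F (i, j).
Proof. by rewrite pair_bigA; apply: eq_bigr => -[]. Qed.

Lemma pr_split (T : finType) (t : X -> T) (b : X -> bool) i : mfib t -> mfib b ->
  pr mu (t @^-1` [set i]) = pr mu ((fun x => (t x, b x)) @^-1` [set (i, true)]) +
    pr mu ((fun x => (t x, b x)) @^-1` [set (i, false)]).
Proof.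
move=> mt mb; have mtb := measurable_fibers_pair mt mb.
transitivity (mean (fun x => (t x == i)%:R)).
  rewrite (mean_fibers mu (fun j => (j == i)%:R) mt) (bigD1 i) //= eqxx mulr1.
  by rewrite big1 ?addr0// => j /negbTE ->; rewrite mulr0.
rewrite (mean_fibers mu (fun p => (p.1 == i)%:R) mtb) sum_pair /=.
rewrite (bigD1 i) //= eqxx big_bool !mulr1 big1 ?addr0// => j /negbTE ->.
by rewrite big1// => c _; rewrite mulr0.
Qed.

(* [v i] is the better guess of the bit [b] on the fibre over [i]; the entropy
   gained by observing [b] dominates the probability of guessing wrong. *)
Lemma fiber_entropy_gain (T : finType) (t : X -> T) (b : X -> bool) (v : T -> bool) :
  mfib t -> mfib b ->
  (forall i, v i = (pr mu ((fun x => (t x, b x)) @^-1` [set (i, false)])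
    <= pr mu ((fun x => (t x, b x)) @^-1` [set (i, true)]))) ->
  fiber_entropy t + mean (fun x => (b x != v (t x))%:R)
    <= fiber_entropy (fun x => (t x, b x)).
Proof.
move=> mt mb vE; have mtb := measurable_fibers_pair mt mb.
pose p i c := pr mu ((fun x => (t x, b x)) @^-1` [set (i, c)]).
rewrite (mean_fibers mu (fun p => (p.2 != v p.1)%:R) mtb).
rewrite sum_pair /= /fiber_entropy /entropy [\sum_(i : T * bool) _]sum_pair.
rewrite -!sumrN -big_split /=; apply: ler_sum => i _.
rewrite !big_bool /= (pr_split i mt mb) -/(p i true) -/(p i false).
have p0 c : 0 <= p i c by exact: pr_ge0.
have := entropy_split_ge_min (p0 true) (p0 false).
rewrite (_ : Num.min _ _ = p i true * (true != v i)%:R + p i false * (false != v i)%:R).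
  by set x := (_ + _) * ln _; set y := _ * ln _; set z := _ * ln _; lra.
rewrite vE -/(p i true) -/(p i false).
by case: leP => /= _; rewrite !(mulr0, mulr1) ?add0r ?addr0.
Qed.

End Entropy.

(** * Pattern entropy and total boundedness *)

Section PatternEntropy.
Context {d : measure_display} {X : measurableType d} {R : realType}.
Variables (mu : probability X R) (G : choiceType) (L : group_law G).
Variable act : G -> X -> X.
Hypothesis Hact : mp_action mu L act.
Local Notation bm := (@bounded_measurable d X R).
Local Notation mfib := measurable_fibers.
Local Notation mean := (mean mu).
Local Notation rho := (orbit_dist mu act).
Local Notation colourable := (@finitely_colourable R G).

Definition name (T : finType) (t : X -> T) n (g : 'I_n -> G) (x : X) : {ffun 'I_n -> T} :=
  [ffun j => t (act (g j) x)].

Lemma measurable_fibers_name (T : finType) (t : X -> T) n (g : 'I_n -> G) :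
  mfib t -> mfib (name t g).
Proof.
by move=> mt; apply: measurable_fibers_ffun => j; exact: (measurable_fibers_act Hact).
Qed.

Lemma join_entropy_name k (A : 'I_k -> set X) (t : X -> 'I_k) n (g : 'I_n -> G) :
  (forall i x, A i x <-> t x = i) ->
  join_entropy mu act A g = fiber_entropy mu (name t g).
Proof.
move=> tE; rewrite /join_entropy /fiber_entropy /entropy; congr (- _).
apply: eq_bigr => v _; suff -> : \bigcap_(j in [set: 'I_n]) (act (g j) @^-1` A (v j)) =
  name t g @^-1` [set v] by [].
apply/seteqP; split => x /=.
  move=> xv; apply/ffunP => j; rewrite ffunE; apply/tE; exact: xv.
by move=> <- j _ /=; apply/tE; rewrite ffunE.
Qed.

Lemma max_pattern_entropy_part_ge k (A : 'I_k -> set X) (a : R) :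
  (forall n, exists g : 'I_n.+1 -> G, a * n.+1%:R <= join_entropy mu act A g) ->
  (a%:E <= max_pattern_entropy_part mu act A)%E.
Proof.
move=> H; apply: limn_esup_ge => N; exists N.+1 => //; have [g ag] := H N.
apply: (@le_trans _ _ ((N.+1%:R)^-1 * join_entropy mu act A g)%:E).
  by rewrite lee_fin mulrC ler_pdivlMr.
by apply: ereal_sup_ubound; exists g.
Qed.

Lemma max_pattern_entropy_ge_part k (A : 'I_k -> set X) : is_partition A ->
  (max_pattern_entropy_part mu act A <= max_pattern_entropy mu act)%E.
Proof. by move=> pA; apply: ereal_sup_ubound; exists k, A. Qed.

Lemma max_pattern_entropy_ge0 : (0 <= max_pattern_entropy mu act)%E.
Proof.
pose A (i : 'I_1) : set X := setT.
have pA : is_partition A.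
  split; first by move=> i; exact: measurableT.
  split; first by move=> i j; rewrite !ord1 eqxx.
  by apply/seteqP; split => // x _; exists ord0.
have [t [mt tE]] := partition_index pA.
apply: le_trans (max_pattern_entropy_ge_part pA).
apply: max_pattern_entropy_part_ge => n; exists (fun=> gone L).
rewrite mul0r (join_entropy_name _ tE); apply: fiber_entropy_ge0.
exact: measurable_fibers_name.
Qed.

Section Greedy.
Variables (B : set X) (mB : measurable B).
Let b x := x \in B.
Let mb : mfib b. Proof. exact: measurable_fibers_bool. Qed.

(** If every translate gained less than [e], each would be guessed from [t] with error at most [e].
    The guessing rule is then a finite colouring: translates sharing a rule are within [2 * e]. *)
Lemma entropy_increment (T : finType) (t : X -> T) (e : R) : mfib t ->
  ~ (exists (U : finType) (c : G -> U), forall g h, c g = c h -> rho \1_B g h <= 2 * e) ->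
  exists g, fiber_entropy mu t + e <= fiber_entropy mu (fun x => (t x, b (act g x))).
Proof.
move=> mt noc; apply: contrapT => nog; apply: noc.
have mbg g : mfib (fun x => b (act g x)) by exact: (measurable_fibers_act Hact).
pose v g : {ffun T -> bool} := [ffun i =>
   pr mu ((fun x => (t x, b (act g x))) @^-1` [set (i, false)])
    <= pr mu ((fun x => (t x, b (act g x))) @^-1` [set (i, true)])].
pose err g := mean (fun x => (b (act g x) != v g (t x))%:R).
have errE g : err g <= e.
  have gain := fiber_entropy_gain mt (mbg g) (fun i => ffunE _ i : v g i = _).
  rewrite leNgt; apply/negP => h; apply: nog; exists g; apply: le_trans gain.
  by rewrite lerD2l ltW.
exists {ffun T -> bool}, v => g h gh.
have bE a c : bm (fun x => (b (act a x) != v c (t x))%:R).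
  apply: (@bm_fibers _ _ _ _ (fun x => (t x, b (act a x))) (fun p => (p.2 != v c p.1)%:R)).
  exact: measurable_fibers_pair.
apply: (@le_trans _ _ (err g + err h)); last by rewrite mulr_natl mulr2n lerD.
rewrite /err -meanD//; apply: le_mean; last 2 first.
- exact: bmD.
- move=> x; rewrite gh !indicE -/(b (act g x)) -/(b (act h x)).
  by case: (b (act g x)); case: (b (act h x)); case: (v h (t x));
    rewrite /= ?subrr ?subr0 ?sub0r ?normrN ?normr0 ?normr1 ?addr0 ?add0r// -natrD ler_nat.
exact: (bm_orbit_diff Hact (bm_indic mB)).
Qed.

Lemma zero_entropy_colourable : max_pattern_entropy mu act = 0%E -> colourable (rho \1_B).
Proof.
move=> h0 e0 e0_gt0; apply: contrapT => noc.
pose e := e0 / 2; have e_gt0 : 0 < e by rewrite divr_gt0.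
have noc' : ~ exists (U : finType) (c : G -> U),
    forall g h, c g = c h -> rho \1_B g h <= 2 * e.
  by rewrite /e mulrC mulfVK ?pnatr_eq0.
pose A := dichotomy B; pose t := dichotomy_index B.
have tE i x : A i x <-> t x = i by exact: dichotomy_indexP.
have pA : is_partition A by exact: is_partition_dichotomy.
have mt : mfib t.
  exact: (measurable_fibers_comp (fun c : bool => if c then ord0 else ord_max) mb).
have grow : forall n, exists g : 'I_n -> G, e * n%:R <= fiber_entropy mu (name t g).
  elim=> [|n [g IH]].
    exists (fun=> gone L); rewrite mulr0; apply: fiber_entropy_ge0.
    exact: measurable_fibers_name.
  have [a aP] := entropy_increment (measurable_fibers_name g mt) noc'.
  exists (fun j : 'I_n.+1 => if unlift ord_max j is Some i then g i else a).
  rewrite -natr1 mulrDr mulr1; apply: (le_trans (lerD IH (lexx e))).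
  apply: (le_trans aP); rewrite le_eqVlt; apply/orP; left; apply/eqP.
  (* The old name paired with the new bit induces the same partition as the name extended by [a] in
     last position. *)
  apply: eq_fiber_entropy.
  - apply: measurable_fibers_pair; first exact: measurable_fibers_name.
    exact: (measurable_fibers_act Hact).
  - exact: measurable_fibers_name.
  have tb x y : (t x = t y) <-> (b x = b y).
    by rewrite /t /dichotomy_index -!/(b _); case: (b x); case: (b y); split => // /(congr1 val).
  move=> x y; split.
    case=> /ffunP xy bxy; apply/ffunP => j; rewrite !ffunE.
    case: (unliftP ord_max j) => [i _|_]; last exact/tb.
    by have := xy i; rewrite !ffunE.
  move=> /ffunP xy; congr (_, _).
    apply/ffunP => i; have := xy (lift ord_max i); rewrite !ffunE.
    by rewrite liftK.
  by apply/tb; have := xy ord_max; rewrite !ffunE unlift_none.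
have := max_pattern_entropy_ge_part pA; rewrite h0; apply/negP; rewrite -ltNge.
apply: (@lt_le_trans _ _ e%:E); first by rewrite lte_fin.
apply: max_pattern_entropy_part_ge => n; have [g gP] := grow n.+1.
by exists g; rewrite (join_entropy_name _ tE).
Qed.

End Greedy.

(* Gibbs' inequality against the mixture [q], over all names [a] of the net [s],
   of products of channels that change each predicted letter with
   probability less than [h]. *)
Lemma name_entropy_le k (t : X -> 'I_k) (m : nat) (s : 'I_m -> G) (c : G -> 'I_m)
    (kappa h : R) (n : nat) (g : 'I_n -> G) : mfib t -> 0 < h < 1 ->
  (forall a, rho (fun x => (t x)%:R) a (s (c a)) <= kappa) ->
  fiber_entropy mu (name t g) <= ln #|{ffun 'I_m -> 'I_k}|%:R
    + n%:R * (- ln (1 - h) + - ln (h / k%:R) * kappa).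
Proof.
move=> mt /andP[h0 h1] net.
have [x0 _] := probability_point mu.
have k0 : 0 < (k%:R : R) by rewrite ltr0n; case: (t x0) => i; exact: leq_ltn_trans.
set K := #|_|; have K0 : 0 < (K%:R : R).
  by rewrite ltr0n; apply/card_gt0P; exists (name t s x0).
have h1' : 0 < 1 - h by rewrite subr_gt0.
have hk : 0 < h / k%:R by rewrite divr_gt0.
pose w (u v : 'I_k) := if u == v then 1 - h else h / k%:R.
have w0 u v : 0 < w u v by rewrite /w; case: ifP.
pose q1 (a : {ffun 'I_m -> 'I_k}) (y : {ffun 'I_n -> 'I_k}) : R :=
  K%:R^-1 * \prod_i w (y i) (a (c (g i))).
have q10 a y : 0 < q1 a y by rewrite mulr_gt0 ?invr_gt0// prodr_gt0.
pose q y := \sum_a q1 a y.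
have qge a y : q1 a y <= q y by rewrite /q (bigD1 a) //= lerDl sumr_ge0// => ? _; exact: ltW.
have q0 y : 0 < q y by apply: lt_le_trans (qge (name t s x0) y).
(* The other letters are at most [k] in number, so their total weight is at most [h]. *)
have wsum v : \sum_u w u v <= 1.
  rewrite (bigD1 v) //= {1}/w eqxx.
  rewrite (eq_bigr (fun=> h / k%:R)); last by move=> u /negbTE uv; rewrite /w uv.
  apply: (@le_trans _ _ (1 - h + \sum_(u : 'I_k) h / k%:R)).
    rewrite lerD2l [leRHS](bigD1 v) //= lerDr; exact: ltW.
  by rewrite sumr_const card_ord -[_ *+ k]mulr_natr mulfVK ?gt_eqF// subrK.
have qsum : \sum_y q y <= 1.
  rewrite exchange_big /=; apply: (@le_trans _ _ (\sum_(a : {ffun 'I_m -> 'I_k}) K%:R^-1)).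
    apply: ler_sum => a _; rewrite -mulr_sumr ler_piMr ?invr_ge0//.
    rewrite -(bigA_distr_bigA (fun i u => w u (a (c (g i))))).
    by apply: prodr_ile1 => i _; rewrite wsum andbT sumr_ge0// => u _; exact: ltW.
  by rewrite sumr_const -[_ *+ _]mulr_natr mulVf// gt_eqF.
apply: (le_trans (gibbs mu (measurable_fibers_name g mt) q0 qsum)).
pose mis a x : R := (t (act a x) != t (act (s (c a)) x))%:R.
have bmis a : bm (mis a).
  apply: (@bm_fibers _ _ _ _ (fun x => (t (act a x), t (act (s (c a)) x)))
    (fun p => (p.1 != p.2)%:R)).
  by apply: measurable_fibers_pair; exact: (measurable_fibers_act Hact).
have bt : bm (fun x => (t x)%:R).
  exact: (@bm_fibers _ _ _ _ t (fun i : 'I_k => (i : nat)%:R)).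
have mmis a : mean (mis a) <= kappa.
  apply: le_trans (net a); apply: le_mean => //; first exact: (bm_orbit_diff Hact bt).
  by move=> x; exact: neq_le_natr_dist.
have ln1h : 0 <= - ln (1 - h) by rewrite oppr_ge0 ln_le0// gerBl ltW.
have lnhk : 0 <= - ln (h / k%:R).
  rewrite oppr_ge0 ln_le0// ler_pdivrMr// mul1r (le_trans (ltW h1))// ler1n.
  by rewrite -(ltr0n R).
have bR : bm (fun x => ln K%:R + \sum_(i < n) (- ln (1 - h) + - ln (h / k%:R) * mis (g i) x)).
  apply: bmD; first exact: bm_cst.
  apply: bm_sum => i; apply: bmD; first exact: bm_cst.
  by apply: bmM => //; exact: bm_cst.
apply: (@le_trans _ _ (mean (fun x =>
   ln K%:R + \sum_(i < n) (- ln (1 - h) + - ln (h / k%:R) * mis (g i) x)))).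
  apply: le_mean => //.
    apply: (@bm_fibers _ _ _ _ (name t g) (fun y => - ln (q y))).
    exact: measurable_fibers_name.
  (* The mixture is bounded below by the component of the true net name of [x], where only
     mispredicted letters pay [- ln (h / k)]. *)
  move=> x; rewrite lerNl; set a := name t s x.
  apply: (@le_trans _ _ (ln (q1 a (name t g x)))); last by rewrite ler_ln// posrE.
  rewrite /q1 [leRHS]lnM ?posrE ?invr_gt0 ?prodr_gt0// [ln K%:R^-1]lnV ?posrE//.
  rewrite opprD lerD2l -sumrN.
  have -> : ln (\prod_i w (name t g x i) (a (c (g i)))) =
      \sum_i ln (w (name t g x i) (a (c (g i)))).
    by apply: ln_prod => i; exact: w0.
  apply: ler_sum => i _; rewrite /w /a !ffunE /mis opprD opprK mulNr opprK.
  case: (eqVneq (t (act (g i) x)) _) => _ /=; first by rewrite mulr0 addr0.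
  by rewrite mulr1 gerDr -oppr_ge0.
rewrite meanD; [|exact: bm_cst|]; last first.
  apply: bm_sum => i; apply: bmD; first exact: bm_cst.
  by apply: bmM => //; exact: bm_cst.
rewrite mean_cst lerD2l mean_sum; last first.
  move=> i; apply: bmD; first exact: bm_cst.
  by apply: bmM => //; exact: bm_cst.
rewrite [leRHS](_ : _ = \sum_(i < n) (- ln (1 - h) + - ln (h / k%:R) * kappa)); last first.
  by rewrite sumr_const card_ord mulr_natl.
apply: ler_sum => i _; rewrite meanD; [|exact: bm_cst|]; last first.
  by apply: bmM => //; exact: bm_cst.
by rewrite mean_cst lerD2l meanZ// ler_wpM2l.
Qed.

Lemma colourable_zero_entropy k (A : 'I_k -> set X) (t : X -> 'I_k) :
  mfib t -> (forall i x, A i x <-> t x = i) ->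
  colourable (rho (fun x => (t x)%:R)) ->
  (max_pattern_entropy_part mu act A <= 0)%E.
Proof.
move=> mt tE ct; apply/lee_addgt0Pr => e e0; rewrite add0e.
(* The budget [e] is split in three: this [h] makes [- ln (1 - h) = e / 3], the net radius controls
   the mispredictions, and [N] makes the constant [K] at most [n * (e / 3)]. *)
pose h := 1 - expR (- (e / 3)).
have e3 : 0 < e / 3 by rewrite divr_gt0.
have h01 : 0 < h < 1.
  rewrite /h subr_gt0 gtrBl expR_gt0 andbT -[ltRHS]expR0 ltr_expR.
  by rewrite oppr_lt0.
pose al := - ln (h / k%:R).
have al0 : 0 < `|al| + 1 by rewrite ltr_wpDl.
have [m [s /choice[c cP]]] := colourable_net ct (divr_gt0 e3 al0).
pose K := ln (#|{ffun 'I_m -> 'I_k}|%:R : R).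
pose N := (Num.truncn (3 * `|K| / e)).+1.
apply: (@limn_esup_le _ _ _ N) => n Nn.
apply: ge_ereal_sup => _ [g _ <-]; rewrite lee_fin (join_entropy_name _ tE).
have n0 : 0 < (n%:R : R) by rewrite ltr0n (leq_trans _ Nn).
rewrite mulrC ler_pdivrMr//; apply: (le_trans (name_entropy_le g mt h01 cP)).
rewrite -/K -/al.
have ln1h : - ln (1 - h) = e / 3.
  by rewrite /h opprB addrC subrK expRK opprK.
have k3 : al * (e / 3 / (`|al| + 1)) <= e / 3.
  rewrite mulrCA; apply: ler_piMr; first exact: ltW.
  rewrite ler_pdivrMr// mul1r.
  by rewrite (le_trans (ler_norm _))// lerDl.
have K3 : K <= n%:R * (e / 3).
  apply: (le_trans (ler_norm _)).
  have : 3 * `|K| / e <= n%:R.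
    by apply: (le_trans (ltW (truncnS_gt _))); rewrite ler_nat.
  rewrite ler_pdivrMr// => H.
  by rewrite mulrA ler_pdivlMr// mulrC.
rewrite ln1h.
have := ler_wpM2l (ltW n0) k3; rewrite !mulrDr; lra.
Qed.

End PatternEntropy.

Theorem theorem4p9 (d : measure_display) (X : measurableType d) (R : realType)
  (mu : probability X R) (G : countType) (L : group_law G) (act : G -> X -> X)
  (HX : standard_borel X R)
  (Hact : mp_action mu L act)
  (HGinf : infinite_set [set: G])
  (HGam : amenable L R) :
  [<-> discrete_spectrum mu act;
       max_pattern_entropy mu act = 0%E;
       forall (k : nat) (A : 'I_k -> set X), is_partition A -> bmc_along_G mu act A;
       forall (k : nat) (A : 'I_k -> set X), is_partition A ->
         forall F, @folner G L F R -> bmc_wrt mu act A F;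
       forall A : 'I_2 -> set X, is_partition A ->
         exists F, @folner G L F R /\ bmc_wrt mu act A F;
       forall (k : nat) (A : 'I_k -> set X), is_partition A ->
         forall F, @folner G L F R -> @tempered G L F R -> mean_equicont mu act A F;
       forall A : 'I_2 -> set X, is_partition A ->
         exists F, [/\ @folner G L F R, @tempered G L F R & mean_equicont mu act A F]].
Proof.
have index_colourable : discrete_spectrum mu act ->
    forall (k : nat) (A : 'I_k -> set X), is_partition A ->
    exists t : X -> 'I_k, [/\ measurable_fibers t, forall i x, A i x <-> t x = i &
      finitely_colourable (orbit_dist mu act (fun x => (t x)%:R))].
  move=> DS k A /partition_index[t [mt tE]]; exists t; split => //.
  exact: (discrete_spectrum_colourable Hact mt DS).
(* Condition (5) is tested on the partition of [X] into [B] and its complement, for every measurable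
   [B]. *)
have bmc_discrete : (forall A : 'I_2 -> set X, is_partition A ->
    exists F, @folner G L F R /\ bmc_wrt mu act A F) -> discrete_spectrum mu act.
  move=> H; apply: (colourable_discrete_spectrum Hact) => B mB.
  have [F [FF bF]] := H _ (is_partition_dichotomy mB).
  exact: (bmc_colourable Hact mB FF bF).
(* The cycle is closed through discrete spectrum: (2) to (3) and (5) to (6) first recover (1), and
   (7) gives (1) by way of (5). *)
tfae.
- move=> DS; apply/eqP; rewrite eq_le (max_pattern_entropy_ge0 Hact) andbT.
  apply: ge_ereal_sup => _ [k [A [pA ->]]].
  have [t [mt tE ct]] := index_colourable DS k A pA.
  exact: (colourable_zero_entropy Hact mt tE ct).
- move=> H0 k A pA; have DS : discrete_spectrum mu act.
    apply: (colourable_discrete_spectrum Hact) => B mB.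
    exact: (zero_entropy_colourable Hact mB H0).
  have [t [mt tE ct]] := index_colourable DS k A pA.
  exact: (colourable_bmc Hact pA mt tE ct).
- move=> H k A pA F FF e e0; have [C CP] := H k A pA e e0.
  by exists C => n; apply: CP; exact: FF.1.
- by move=> H A pA; have [F FF] := HGam; exists F; split => //; exact: H.
- move=> /bmc_discrete DS k A pA F FF FT.
  have [t [mt tE ct]] := index_colourable DS k A pA.
  exact: (colourable_mean_equicont Hact pA mt tE ct FF FT).
- move=> H A pA; have [F FF] := HGam; have [F' [FF' FT']] := tempered_subsequence FF.
  by exists F'; split => //; exact: H.
- move=> H; apply: bmc_discrete => A pA; have [F [FF _ eF]] := H A pA.
  by exists F; split => //; exact: (mean_equicont_bmc Hact pA eF).
Qed.
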